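(* Let $n\ge 2$, let $\Bbbk$ be a field containing a primitive $n$-th root of unity $\omega$, and let $H=H_{n^2}$ be the Taft Hopf algebra. The orbits of the left coideal subalgebras of $H$ under the automorphism group of the Hopf algebra $H$ are as follows: (1) a fixed point $\Bbbk\langle g^d\rangle$ for each divisor $d\mid n$; (2) a fixed point $\mathcal{N}_{d,x}$ for each divisor $d\mid n$; (3) the orbit consisting of all $\mathcal{N}_\beta$ for $\beta\in\Bbbk^\times$.
   Context: The Taft Hopf algebra $H_{n^2}$ is the algebra $\Bbbk[x]/(x^n)\rtimes\Bbbk[G]$, where $G=\mathbb{Z}/n\mathbb{Z}$ is generated by $g$ (so $g^n=1$, $x^n=0$) and $gxg^{-1}=\omega x$; its coalgebra structure is $\Delta(g)=g\otimes g$, $\Delta(x)=x\otimes 1+g\otimes x$. A left coideal subalgebra of a Hopf algebra $\mathcal{A}$ is a unital subalgebra $\mathcal{N}$ with $\Delta(\mathcal{N})\subset\mathcal{A}\otimes\mathcal{N}$. $\Bbbk\langle g^d\rangle$ is the group algebra of the subgroup of $G$ generated by $g^d$; $\mathcal{N}_{d,x}$ is the unital subalgebra generated by $g^d$ and $x$; $\mathcal{N}_\beta$ is the subalgebra generated by $g+\beta x$. $\Bbbk^\times=\Bbbk\setminus\{0\}$. *)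

(* Defs.v *)
From HB Require Import structures.
From mathcomp Require Import all_boot all_order all_algebra all_field.
From mathcomp Require Import ring classical_sets.

Set Implicit Arguments.
Unset Strict Implicit.
Unset Printing Implicit Defensive.

Import GRing.Theory.
Import VectorInternalTheory.
Local Open Scope ring_scope.

(* The tensor product over k of two finite-dimensional algebras: t : tensor A B
   stands for the sum of the t i j *: (e_i (x) e'_j), where e and e' are the
   bases of A and B given by their vectType structures (bvec below). *)
Definition tensor (k : fieldType) (A B : falgType k) : Type :=
  'M[k]_(dim A, dim B).

Definition bvec (k : fieldType) (V : vectType k) (i : 'I_(dim V)) : V :=
  r2v (delta_mx 0 i).

HB.instance Definition _ (k : fieldType) (A B : falgType k) :=
  Vector.copy (tensor A B) 'M[k]_(dim A, dim B).

Definition tens (k : fieldType) (A B : falgType k) (a : A) (b : B) :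
  tensor A B := (v2r a)^T *m v2r b.

(* The linear map on A (x) B induced by a bilinear map F. *)
Definition tlift (k : fieldType) (A B : falgType k) (C : lmodType k)
    (F : A -> B -> C) (t : tensor A B) : C :=
  \sum_i \sum_j t i j *: F (bvec i) (bvec j).

Lemma linear_scale (k : fieldType) (U V : lmodType k) (f : U -> V) :
  linear f -> forall c u, f (c *: u) = c *: f u.
Proof.
move=> fP c u; have f0 : f 0 = 0.
  by have:= fP (-1) 0 0; rewrite scaler0 addr0 scaleN1r addNr.
by have:= fP c u 0; rewrite f0 !addr0.
Qed.

Section TensorTheory.
Variable k : fieldType.
Implicit Types A B : falgType k.

Lemma bvec_sum (V : vectType k) (v : V) : v = \sum_i v2r v 0 i *: bvec i.
Proof.
rewrite -[LHS]v2rK [in LHS](row_sum_delta (v2r v)) linear_sum.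
by apply: eq_bigr => i _; rewrite linearZ.
Qed.

Lemma v2r_bvec (V : vectType k) (i : 'I_(dim V)) : v2r (bvec i) = delta_mx 0 i.
Proof. exact: r2vK. Qed.

Lemma tens_linearl A B (b : B) : linear (fun a : A => tens a b).
Proof.
move=> c u v; rewrite /tens !linearP /=.
by rewrite mulmxDl -scalemxAl.
Qed.

Lemma tens_linearr A B (a : A) : linear (fun b : B => tens a b).
Proof. by move=> c u v; rewrite /tens !linearP. Qed.

Lemma tensE A B (t : tensor A B) :
  t = \sum_i \sum_j t i j *: tens (bvec i) (bvec j).
Proof.
rewrite [LHS]matrix_sum_delta; apply: eq_bigr => i _; apply: eq_bigr => j _.
by rewrite /tens !v2r_bvec trmx_delta mul_delta_mx.
Qed.

Lemma tlift_linear A B (C : lmodType k) (F : A -> B -> C) : linear (tlift F).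
Proof.
move=> c s t; rewrite /tlift scaler_sumr -big_split; apply: eq_bigr => i _ /=.
rewrite scaler_sumr -big_split; apply: eq_bigr => j _ /=.
by rewrite !mxE scalerDl scalerA.
Qed.

Lemma tlift_tens A B (C : lmodType k) (F : A -> B -> C) (a : A) (b : B) :
  (forall b', linear (F^~ b')) -> (forall a', linear (F a')) ->
  tlift F (tens a b) = F a b.
Proof.
move=> Fl Fr.
pose Fl' b' := GRing.isLinear.Build k A C *:%R (F^~ b') (Fl b').
pose fl b' : {linear A -> C} := HB.pack (F^~ b') (Fl' b').
pose Fr' a' := GRing.isLinear.Build k B C *:%R (F a') (Fr a').
pose fr a' : {linear B -> C} := HB.pack (F a') (Fr' a').
rewrite [in RHS](bvec_sum a) -[RHS]/(fl _ _) linear_sum.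
apply: eq_bigr => i _; rewrite linearZ /= -[F _ b]/(fr _ b).
rewrite [in RHS](bvec_sum b) linear_sum scaler_sumr; apply: eq_bigr => j _.
by rewrite linearZ /= scalerA /tens !mxE big_ord1 !mxE.
Qed.


Lemma tlift_linearF A B (C D : lmodType k) (F : D -> A -> B -> C) (t : tensor A B) :
  (forall a b, linear (fun d => F d a b)) -> linear (fun d => tlift (F d) t).
Proof.
move=> FP c u v; rewrite /tlift scaler_sumr -big_split; apply: eq_bigr => i _ /=.
rewrite scaler_sumr -big_split; apply: eq_bigr => j _ /=.
by rewrite FP scalerDr !scalerA mulrC.
Qed.

Lemma tensor_ext A B (C : lmodType k) (f h : tensor A B -> C) :
  linear f -> linear h -> (forall a b, f (tens a b) = h (tens a b)) -> f =1 h.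
Proof.
move=> fP hP fh t.
pose Fl := GRing.isLinear.Build k (tensor A B) C *:%R f fP.
pose fl : {linear tensor A B -> C} := HB.pack f Fl.
pose Hl := GRing.isLinear.Build k (tensor A B) C *:%R h hP.
pose hl : {linear tensor A B -> C} := HB.pack h Hl.
rewrite -[f t]/(fl t) -[h t]/(hl t) (tensE t) !linear_sum.
apply: eq_bigr => i _; rewrite !linear_sum; apply: eq_bigr => j _.
by rewrite !linearZ /= fh.
Qed.

End TensorTheory.

Section TensorAlgebra.
Variables (k : fieldType) (A B : falgType k).

Definition tens_mul (s t : tensor A B) : tensor A B :=
  tlift (fun a b => tlift (fun c d => tens (a * c) (b * d)) t) s.

Lemma tens_mul_linearl t : linear (fun s => tens_mul s t).
Proof. exact: tlift_linear. Qed.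

Lemma tens_mul_linearr s : linear (tens_mul s).
Proof. by apply: tlift_linearF => a b; apply: tlift_linear. Qed.

Lemma tens_mulE a b c d :
  tens_mul (tens a b) (tens c d) = tens (a * c) (b * d).
Proof.
rewrite /tens_mul tlift_tens => [|b'|a'].
- rewrite tlift_tens // => [b'|a'] z u v.
    by rewrite mulrDr -scalerAr tens_linearl.
  by rewrite mulrDr -scalerAr tens_linearr.
- by apply: tlift_linearF => u v z w w'; rewrite mulrDl -scalerAl tens_linearl.
- by apply: tlift_linearF => u v z w w'; rewrite mulrDl -scalerAl tens_linearr.
Qed.

Fact tens_mulA : associative tens_mul.
Proof.
move=> s t u; move: s.
apply: tensor_ext => [z s s'|z s s'|a b]; rewrite ?tens_mul_linearl //.
move: t; apply: tensor_ext => [z t t'|z t t'|c d].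
- by rewrite tens_mul_linearl tens_mul_linearr.
- by rewrite tens_mul_linearr tens_mul_linearl.
move: u; apply: tensor_ext => [z u u'|z u u'|e f]; rewrite ?tens_mul_linearr //.
by rewrite !tens_mulE !mulrA.
Qed.

Fact tens_mul1l : left_id (tens 1 1) tens_mul.
Proof.
apply: tensor_ext => [||a b]; [exact: tens_mul_linearr | by [] |].
by rewrite tens_mulE !mul1r.
Qed.

Fact tens_mul1r : right_id (tens 1 1) tens_mul.
Proof.
apply: tensor_ext => [||a b]; [exact: tens_mul_linearl | by [] |].
by rewrite tens_mulE !mulr1.
Qed.

Fact tens_mulDl : left_distributive tens_mul +%R.
Proof. by move=> s s' t; have:= tens_mul_linearl t 1 s s'; rewrite !scale1r. Qed.

Fact tens_mulDr : right_distributive tens_mul +%R.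
Proof. by move=> s t t'; have:= tens_mul_linearr s 1 t t'; rewrite !scale1r. Qed.

Fact tens1_neq0 : tens 1 1 != 0 :> tensor A B.
Proof.
have rV_neq0 (V : falgType k) : exists i, v2r (1 : V) 0 i != 0.
  have: v2r (1 : V) != 0.
    by apply: contraNneq (oner_neq0 V) => v0; rewrite -[1]v2rK v0 linear0.
  by case/rV0Pn=> i; exists i.
have [[i ai] [j bj]] := (rV_neq0 A, rV_neq0 B).
apply/eqP=> /matrixP/(_ i j); rewrite !mxE big_ord1 !mxE => /eqP.
by rewrite mulf_eq0 (negPf ai) (negPf bj).
Qed.

HB.instance Definition _ := GRing.Zmodule_isNzRing.Build (tensor A B)
  tens_mulA tens_mul1l tens_mul1r tens_mulDl tens_mulDr tens1_neq0.

Fact tens_scaleAl (z : k) (s t : tensor A B) : z *: (s * t) = (z *: s) * t.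
Proof.
by have:= tens_mul_linearl t z s 0; rewrite (mul0r t : tens_mul 0 t = 0) !addr0.
Qed.

HB.instance Definition _ :=
  GRing.Lmodule_isLalgebra.Build k (tensor A B) tens_scaleAl.

Fact tens_scaleAr (z : k) (s t : tensor A B) : z *: (s * t) = s * (z *: t).
Proof.
by have:= tens_mul_linearr s z t 0; rewrite (mulr0 s : tens_mul s 0 = 0) !addr0.
Qed.

HB.instance Definition _ :=
  GRing.Lalgebra_isAlgebra.Build k (tensor A B) tens_scaleAr.
HB.instance Definition _ := Algebra_isFalgebra.Build k (tensor A B).

Lemma tensM (a c : A) (b d : B) : tens a b * tens c d = tens (a * c) (b * d).
Proof. exact: tens_mulE. Qed.

Lemma tens1 : tens 1 1 = 1 :> tensor A B.
Proof. by []. Qed.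

Definition tensv (U : {vspace A}) (V : {vspace B}) : {vspace tensor A B} :=
  <<[seq tens u v | u <- vbasis U, v <- vbasis V]>>%VS.

Lemma memv_tens (U : {vspace A}) (V : {vspace B}) (a : A) (b : B) :
  a \in U -> b \in V -> tens a b \in tensv U V.
Proof.
move=> /coord_vbasis-> /coord_vbasis->; set s : B := \sum_(i < \dim V) _.
pose L := GRing.isLinear.Build k A (tensor A B) *:%R (fun a => tens a s)
  (tens_linearl s).
pose l : {linear A -> tensor A B} := HB.pack (fun a => tens a s) L.
rewrite -[tens _ _]/(l _) linear_sum memv_suml // => i _; rewrite linearZ /=.
rewrite memvZ // {L l}/s.
pose R := GRing.isLinear.Build k B (tensor A B) *:%R (tens (vbasis U)`_i)
  (tens_linearr _).
pose r : {linear B -> tensor A B} := HB.pack (tens (vbasis U)`_i) R.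
rewrite -[tens _ _]/(r _) linear_sum memv_suml // => j _; rewrite linearZ /=.
rewrite memvZ // memv_span //.
by apply/allpairsP; exists ((vbasis U)`_i, (vbasis V)`_j); rewrite !memt_nth.
Qed.

Lemma tensvP (U : {vspace A}) (V : {vspace B}) (W : {vspace tensor A B}) :
  reflect {in U & V, forall a b, tens a b \in W} (tensv U V <= W)%VS.
Proof.
apply: (iffP idP) => [sUVW a b Ua Vb | sUVW].
  by rewrite (subvP sUVW) ?memv_tens.
apply/span_subvP=> _ /allpairsP[[u v] /= [Uu Vv ->]].
by rewrite sUVW ?vbasis_mem.
Qed.

End TensorAlgebra.

Section TensorMore.
Variable k : fieldType.

Lemma tensX (A B : falgType k) (a : A) (b : B) m :
  tens a b ^+ m = tens (a ^+ m) (b ^+ m).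
Proof. by elim: m => // m IH; rewrite !exprS IH tensM. Qed.

Lemma tens0l (A B : falgType k) (b : B) : tens (0 : A) b = 0.
Proof. by have:= linear_scale (tens_linearl b) 0 (0 : A); rewrite !scale0r. Qed.

Lemma tens0r (A B : falgType k) (a : A) : tens a (0 : B) = 0.
Proof. by have:= linear_scale (tens_linearr a) 0 (0 : B); rewrite !scale0r. Qed.

HB.instance Definition _ (A B : falgType k) (C : lmodType k) (F : A -> B -> C) :=
  GRing.isLinear.Build k (tensor A B) C *:%R (tlift F) (tlift_linear F).

HB.instance Definition _ (A B : falgType k) (a : A) :=
  GRing.isLinear.Build k B (tensor A B) *:%R (tens a) (tens_linearr a).

Lemma tliftM (A B C : falgType k) (F : A -> B -> C) :
  (forall b, linear (F^~ b)) -> (forall a, linear (F a)) ->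
  (forall a b c d, F (a * c) (b * d) = F a b * F c d) ->
  forall s t, tlift F (s * t) = tlift F s * tlift F t.
Proof.
move=> Fl Fr FM s t; move: s; apply: tensor_ext => [z s s'|z s s'|a b].
- by rewrite mulrDl -scalerAl linearP.
- by rewrite linearP mulrDl -scalerAl.
move: t; apply: tensor_ext => [z t t'|z t t'|c d].
- by rewrite mulrDr -scalerAr linearP.
- by rewrite linearP mulrDr -scalerAr.
by rewrite tensM !tlift_tens.
Qed.

Lemma ahomM (A B : falgType k) (f : 'AHom(A, B)) u v : f (u * v) = f u * f v.
Proof. exact: rmorphM. Qed.

End TensorMore.

Lemma qcommX (k : fieldType) (A : algType k) (q : k) (a b : A) : b * a = q *: (a * b) ->
  forall i j, b ^+ i * a ^+ j = q ^+ (i * j) *: (a ^+ j * b ^+ i).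
Proof.
move=> ba i j; have baj e : b * a ^+ e = q ^+ e *: (a ^+ e * b).
  elim: e => [|e IH]; first by rewrite mulr1 mul1r scale1r.
  rewrite !exprS mulrA ba -scalerAl -(mulrA a b) IH -scalerAr scalerA.
  by rewrite mulrA.
elim: i => [|i IH]; first by rewrite mulr1 mul1r scale1r.
rewrite exprS -(mulrA b) IH -scalerAr (mulrA b) baj -scalerAl scalerA.
by rewrite -exprD addnC mulSn mulrA.
Qed.

Record hopf (k : fieldType) (A : falgType k) := Hopf {
  comul : 'AHom(A, tensor A A);
  counit : 'AHom(A, k^o);
  antipode : 'End(A);
  comulA : forall h, tlift (fun a b => tens (comul a) b) (comul h) =
    tlift (fun a b => tlift (fun c d => tens (tens a c) d) (comul b)) (comul h)
    :> tensor (tensor A A) A;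
  counitl : forall h, tlift (fun a b => counit a *: b) (comul h) = h;
  counitr : forall h, tlift (fun a b => counit b *: a) (comul h) = h;
  antipodel : forall h,
    tlift (fun a b => antipode a * b) (comul h) = (counit h)%:A;
  antipoder : forall h,
    tlift (fun a b => a * antipode b) (comul h) = (counit h)%:A }.

(* The underlying space of the Taft algebra k[x]/(x^n) >< k[G]: the entry h i j
   of a matrix h is the coefficient of the basis element x^i g^j. *)
Definition taft (k : fieldType) (n : nat) (w : k)
  (hw : n.-primitive_root w) : Type := 'M[k]_n.

HB.instance Definition _ (k : fieldType) (n : nat) (w : k)
    (hw : n.-primitive_root w) := Vector.copy (taft hw) 'M[k]_n.

Section TaftAlgebra.
Variables (k : fieldType) (n : nat) (w : k) (hw : n.-primitive_root w).
Local Notation H := (taft hw).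

(* x^a g^b, for arbitrary exponents: x^n = 0 and g^n = 1 *)
Definition mono (a b : nat) : H :=
  \matrix_(i, j) ((i == a :> nat) && (j == b %% n :> nat)%N)%:R.

Definition tsum (C : lmodType k) (F : nat -> nat -> C) (h : H) : C :=
  \sum_(i < n) \sum_(j < n) (h : 'M[k]_n) i j *: F i j.

(* (x^i g^j) (x^p g^q) = w^(jp) x^(i+p) g^(j+q), because g x = w x g *)
Definition taft_mul (h h' : H) : H :=
  tsum (fun i j => tsum (fun p q => w ^+ (j * p) *: mono (i + p) (j + q)) h') h.

Let n_gt0 : (0 < n)%N. Proof. exact: prim_order_gt0 hw. Qed.

Lemma tsum_linear (C : lmodType k) (F : nat -> nat -> C) : linear (tsum F).
Proof.
move=> c s t; rewrite /tsum scaler_sumr -big_split; apply: eq_bigr => i _ /=.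
rewrite scaler_sumr -big_split; apply: eq_bigr => j _ /=.
by rewrite !mxE scalerDl scalerA.
Qed.

Lemma tsum_linearF (C D : lmodType k) (F : D -> nat -> nat -> C) h :
  (forall a b, linear (fun d => F d a b)) -> linear (fun d => tsum (F d) h).
Proof.
move=> FP c u v; rewrite /tsum scaler_sumr -big_split; apply: eq_bigr => i _ /=.
rewrite scaler_sumr -big_split; apply: eq_bigr => j _ /=.
by rewrite FP scalerDr !scalerA mulrC.
Qed.

Lemma tsum_mono (C : lmodType k) (F : nat -> nat -> C) a b :
  (a < n)%N -> tsum F (mono a b) = F a (b %% n)%N.
Proof.
move=> an; have bn : (b %% n < n)%N by rewrite ltn_mod.
rewrite /tsum (bigD1 (Ordinal an)) //= (bigD1 (Ordinal bn)) //= !mxE !eqxx.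
rewrite scale1r !big1 ?addr0 // => [i nia|j njb].
  rewrite big1 // => j _; rewrite !mxE -[a]/(val (Ordinal an)) val_eqE.
  by rewrite (negPf nia) scale0r.
by rewrite mxE -[(b %% n)%N]/(val (Ordinal bn)) val_eqE (negPf njb) andbF scale0r.
Qed.

Lemma mono_ge a b : (n <= a)%N -> mono a b = 0.
Proof.
move=> na; apply/matrixP=> i j; rewrite !mxE.
by case: eqP => // ia; rewrite -ia leqNgt ltn_ord in na.
Qed.

Lemma mono_mod a b : mono a (b %% n) = mono a b.
Proof. by apply/matrixP=> i j; rewrite !mxE modn_mod. Qed.

Lemma taftE (h : H) : h = tsum mono h.
Proof.
rewrite [LHS]matrix_sum_delta; apply: eq_bigr => i _; apply: eq_bigr => j _.
congr (_ *: _); apply/matrixP=> p q; rewrite !mxE !val_eqE.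
by rewrite modn_small.
Qed.

Lemma taft_ext (C : lmodType k) (f h : H -> C) : linear f -> linear h ->
  (forall a b, (a < n)%N -> (b < n)%N -> f (mono a b) = h (mono a b)) ->
  f =1 h.
Proof.
move=> fP hP fh t.
pose Fl := GRing.isLinear.Build k H C *:%R f fP.
pose fl : {linear H -> C} := HB.pack f Fl.
pose Hl := GRing.isLinear.Build k H C *:%R h hP.
pose hl : {linear H -> C} := HB.pack h Hl.
rewrite -[f t]/(fl t) -[h t]/(hl t) (taftE t) !linear_sum.
apply: eq_bigr => i _; rewrite !linear_sum; apply: eq_bigr => j _.
by rewrite !linearZ /= fh.
Qed.

Lemma taft_mul_linearl h' : linear (fun h => taft_mul h h').
Proof. exact: tsum_linear. Qed.

Lemma taft_mul_linearr h : linear (taft_mul h).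
Proof. by apply: tsum_linearF => a b; apply: tsum_linear. Qed.

Lemma taft_mul_mono a b c d :
  taft_mul (mono a b) (mono c d) = w ^+ (b * c) *: mono (a + c) (b + d).
Proof.
have [na|an] := leqP n a.
  rewrite [in RHS]mono_ge ?scaler0 ?(leq_trans na) ?leq_addr // (mono_ge b na).
  by have:= linear_scale (taft_mul_linearl (mono c d)) 0 0; rewrite !scale0r => ->.
have [nc|cn] := leqP n c.
  rewrite [in RHS]mono_ge ?scaler0 ?(leq_trans nc) ?leq_addl // (mono_ge d nc).
  by have:= linear_scale (taft_mul_linearr (mono a b)) 0 0; rewrite !scale0r => ->.
rewrite /taft_mul !tsum_mono // -mono_mod modnDm mono_mod.
by rewrite !exprM (prim_expr_mod hw).
Qed.

Fact taft_mulA : associative taft_mul.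
Proof.
move=> s t u; move: s.
apply: taft_ext => [z s s'|z s s'|a b _ _]; rewrite ?taft_mul_linearl //.
move: t; apply: taft_ext => [z t t'|z t t'|c d _ _].
- by rewrite taft_mul_linearl taft_mul_linearr.
- by rewrite taft_mul_linearr taft_mul_linearl.
move: u; apply: taft_ext => [z u u'|z u u'|e f _ _];
  rewrite ?taft_mul_linearr //.
have mZl z (h h' : H) : taft_mul (z *: h) h' = z *: taft_mul h h'.
  exact: linear_scale (taft_mul_linearl h') z h.
have mZr z (h h' : H) : taft_mul h' (z *: h) = z *: taft_mul h' h.
  exact: linear_scale (taft_mul_linearr h') z h.
rewrite !taft_mul_mono mZl mZr !taft_mul_mono !scalerA !addnA -!exprD.
by congr (w ^+ _ *: _); rewrite mulnDl mulnDr addnC -addnA.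
Qed.

Fact taft_mul1l : left_id (mono 0 0) taft_mul.
Proof.
apply: taft_ext => [||a b _ _]; [exact: taft_mul_linearr | by [] |].
by rewrite taft_mul_mono mul0n scale1r.
Qed.

Fact taft_mul1r : right_id (mono 0 0) taft_mul.
Proof.
apply: taft_ext => [||a b _ _]; [exact: taft_mul_linearl | by [] |].
by rewrite taft_mul_mono muln0 scale1r !addn0.
Qed.

Fact taft_mulDl : left_distributive taft_mul +%R.
Proof. by move=> s s' t; have:= taft_mul_linearl t 1 s s'; rewrite !scale1r. Qed.

Fact taft_mulDr : right_distributive taft_mul +%R.
Proof. by move=> s t t'; have:= taft_mul_linearr s 1 t t'; rewrite !scale1r. Qed.

Fact taft1_neq0 : mono 0 0 != 0.
Proof.
apply/eqP=> /matrixP/(_ (Ordinal n_gt0) (Ordinal n_gt0)) /eqP.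
by rewrite !mxE /= mod0n eqxx oner_eq0.
Qed.

HB.instance Definition _ := GRing.Zmodule_isNzRing.Build H
  taft_mulA taft_mul1l taft_mul1r taft_mulDl taft_mulDr taft1_neq0.

Fact taft_scaleAl (z : k) (s t : H) : z *: (s * t) = (z *: s) * t.
Proof. exact/esym/(linear_scale (taft_mul_linearl t)). Qed.

HB.instance Definition _ := GRing.Lmodule_isLalgebra.Build k H taft_scaleAl.

Fact taft_scaleAr (z : k) (s t : H) : z *: (s * t) = s * (z *: t).
Proof. exact/esym/(linear_scale (taft_mul_linearr s)). Qed.

HB.instance Definition _ := GRing.Lalgebra_isAlgebra.Build k H taft_scaleAr.
HB.instance Definition _ := Algebra_isFalgebra.Build k H.

Definition taft_x : H := mono 1 0.
Definition taft_g : H := mono 0 1.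

Lemma monoM a b c d :
  mono a b * mono c d = w ^+ (b * c) *: mono (a + c) (b + d).
Proof. exact: taft_mul_mono. Qed.

Lemma taft_xX a : taft_x ^+ a = mono a 0.
Proof.
by elim: a => // a IH; rewrite exprS IH monoM mul0n scale1r.
Qed.

Lemma taft_gX b : taft_g ^+ b = mono 0 b.
Proof.
by elim: b => // b IH; rewrite exprS IH monoM muln0 scale1r.
Qed.

Lemma monoE a b : mono a b = taft_x ^+ a * taft_g ^+ b.
Proof. by rewrite taft_xX taft_gX monoM mul0n scale1r addn0. Qed.

Lemma taft_basis (h : H) :
  h = \sum_(i < n) \sum_(j < n)
        (h : 'M[k]_n) i j *: (taft_x ^+ i * taft_g ^+ j).
Proof.
rewrite [LHS]taftE; apply: eq_bigr => i _; apply: eq_bigr => j _.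
by rewrite monoE.
Qed.

Lemma taft_xn : taft_x ^+ n = 0.
Proof. by rewrite taft_xX mono_ge. Qed.

Lemma taft_gn : taft_g ^+ n = 1.
Proof. by rewrite taft_gX -mono_mod modnn. Qed.

Lemma taft_gx : taft_g * taft_x = w *: (taft_x * taft_g).
Proof. by rewrite !monoM mul0n !scale1r. Qed.

Lemma taft_g_unit : taft_g \is a GRing.unit.
Proof.
apply/unitrP; exists (taft_g ^+ n.-1).
by rewrite -exprSr -exprS prednK // taft_gn.
Qed.

Lemma taft_gxg : taft_g * taft_x * taft_g^-1 = w *: taft_x.
Proof. by rewrite taft_gx -scalerAl mulrK // taft_g_unit. Qed.

Lemma taft_gV : taft_g^-1 = taft_g ^+ n.-1.
Proof.
by apply: (mulrI taft_g_unit); rewrite mulrV ?taft_g_unit // -exprS prednK // taft_gn.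
Qed.

HB.instance Definition _ (C : lmodType k) F :=
  GRing.isLinear.Build k H C *:%R (tsum F) (tsum_linear F).

Definition taft_lift (A : falgType k) (X G : A) : 'Hom(H, A) :=
  linfun (tsum (fun i j => X ^+ i * G ^+ j)).

Lemma taft_lift_mono (A : falgType k) (X G : A) a b :
  X ^+ n = 0 -> G ^+ n = 1 -> taft_lift X G (mono a b) = X ^+ a * G ^+ b.
Proof.
move=> Xn Gn; rewrite lfunE /=.
have [na|an] := leqP n a.
  by rewrite mono_ge // linear0 -(subnK na) exprD Xn mulr0 mul0r.
by rewrite tsum_mono // (expr_mod _ Gn).
Qed.

Lemma taft_lift_ahom (A : falgType k) (X G : A) :
  X ^+ n = 0 -> G ^+ n = 1 -> G * X = w *: (X * G) ->
  ahom_in {:H} (taft_lift X G).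
Proof.
move=> Xn Gn GX; have liftE := taft_lift_mono _ _ Xn Gn.
apply/ahom_inP; split=> [s t _ _|]; last by rewrite liftE mulr1.
move: s; apply: taft_ext => [z s s'|z s s'|a b _ _].
- by rewrite mulrDl -scalerAl linearP.
- by rewrite linearP mulrDl -scalerAl.
move: t; apply: taft_ext => [z t t'|z t t'|c d _ _].
- by rewrite mulrDr -scalerAr linearP.
- by rewrite linearP mulrDr -scalerAr.
rewrite monoM linearZ /= !liftE !mulrA -(mulrA (X ^+ a)).
rewrite (qcommX GX).
by rewrite -scalerAr -scalerAl mulrA -exprD -!mulrA -exprD.
Qed.



(* Gaussian binomial coefficients at w *)
Fixpoint qbin (m i : nat) : k :=
  match m, i with
  | _, 0 => 1
  | 0, _.+1 => 0
  | m'.+1, i'.+1 => w ^+ (m' - i') * qbin m' i' + qbin m' i'.+1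
  end.

Lemma qbin0 m : qbin m 0 = 1. Proof. by case: m. Qed.

Lemma qbin_gt m i : (m < i)%N -> qbin m i = 0.
Proof.
elim: m i => [|m IH] [|i] //= mi; rewrite !IH ?mulr0 ?addr0 //.
by apply: ltnW.
Qed.

Lemma qbinn m : qbin m m = 1.
Proof.
elim: m => // m IH; rewrite -[LHS]/(w ^+ (m - m) * qbin m m + qbin m m.+1).
by rewrite IH qbin_gt // subnn mulr1 addr0.
Qed.

Lemma qbinE m i : qbin m i * \prod_(l < i) (w ^+ l.+1 - 1) =
  \prod_(l < i) (w ^+ (m - l) - 1).
Proof.
elim: m i => [|m IH] [|i]; rewrite ?big_ord0 ?qbin0 ?mulr1 //.
  by rewrite /= mul0r big_ord_recl /= expr0 subrr mul0r.
rewrite /= mulrDl IH big_ord_recr /= mulrA -(mulrA (w ^+ _)) IH.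
rewrite [X in _ + X]big_ord_recr big_ord_recl /=.
under [in RHS]eq_bigr => l _ do rewrite subSS.
set F := \prod_(l < i) _; have [im|mi] := leqP i m; last first.
  have -> : F = 0.
    by rewrite /F (bigD1 (Ordinal mi)) //= subnn expr0 subrr mul0r.
  by rewrite !(mulr0, mul0r) addr0.
have -> : w ^+ (m.+1 - 0) = w ^+ (m - i) * w ^+ i.+1.
  by rewrite -exprD addnS subnK // subn0.
by rewrite /=; set u := w ^+ (m - i); set v := w ^+ i.+1; ring.
Qed.

Lemma qexprD (A : algType k) (a b : A) : b * a = w *: (a * b) -> forall m,
  (a + b) ^+ m = \sum_(i < m.+1) qbin m i *: (a ^+ i * b ^+ (m - i)).
Proof.
move=> ba; elim=> [|m IH]; first by rewrite big_ord1 scale1r mulr1.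
rewrite exprSr IH mulr_suml.
rewrite [RHS]big_ord_recl qbin0 scale1r mul1r subn0.
under [in RHS]eq_bigr => i _ do rewrite /= scalerDl subSS.
rewrite big_split /= addrCA.
under [in LHS]eq_bigr => i _ do rewrite -scalerAl mulrDr scalerDr.
rewrite big_split /=; congr (_ + _).
  apply: eq_bigr => i _; rewrite -mulrA.
  have := qcommX ba (m - i) 1; rewrite muln1 !expr1 => ->.
  by rewrite -scalerAr scalerA mulrC mulrA -exprSr.
rewrite big_ord_recl qbin0 scale1r mul1r subn0 -exprSr; congr (_ + _).
rewrite big_ord_recr /= qbin_gt // scale0r addr0.
by apply: eq_bigr => i _; rewrite -mulrA -exprSr /bump /= add1n subnSK.
Qed.

Lemma qexprDn (A : algType k) (a b : A) : b * a = w *: (a * b) ->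
  (a + b) ^+ n = a ^+ n + b ^+ n.
Proof.
move=> ba; have qn0 i : (0 < i)%N -> (i < n)%N -> qbin n i = 0.
  move=> i0 ltin; have := qbinE n i.
  case: i i0 ltin => // i _ ltin; rewrite [RHS]big_ord_recl subn0.
  rewrite (prim_expr_order hw) subrr mul0r => /eqP; rewrite mulf_eq0.
  case/orP=> [/eqP // | /prodf_eq0 [l _]].
  rewrite subr_eq0 -(prim_order_dvd hw) => /(dvdn_leq (ltn0Sn l)).
  by rewrite leqNgt (leq_ltn_trans _ ltin).
rewrite (qexprD ba); have nE : n = n.-1.+1 by rewrite prednK.
move: qn0; rewrite nE; move: n.-1 => m qm0.
rewrite big_ord_recl big_ord_recr big1 => [|i _]; last first.
  by rewrite lift0 qm0 ?scale0r // ltnS (ltn_ord i).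
rewrite qbin0 lift0 qbinn !scale1r subnn mulr1 mul1r subn0.
by rewrite /= add0r addrC.
Qed.

Lemma taft_gen_ind (P : H -> Prop) :
  (forall c u v, P u -> P v -> P (c *: u + v)) ->
  (forall u v, P u -> P v -> P (u * v)) ->
  P 1 -> P taft_x -> P taft_g -> forall h, P h.
Proof.
move=> PD PM P1 Px Pg h.
have P0 : P 0 by rewrite -(addNr 1) -scaleN1r; apply: PD.
have PX u : P u -> forall m, P (u ^+ m).
  by move=> Pu; elim=> // m IH; rewrite exprS; apply: PM.
rewrite (taft_basis h); elim/big_rec: _ => // i s _ Ps.
elim/big_rec: _ => [|j t _ Pt]; first by rewrite add0r.
by rewrite -addrA; apply: PD => //; apply: PM; apply: PX.
Qed.

Local Notation HH := (tensor H H).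

Definition taft_comul_x : HH := tens taft_x 1 + tens taft_g taft_x.
Definition taft_comul_g : HH := tens taft_g taft_g.

Fact taft_comul_xn : taft_comul_x ^+ n = 0.
Proof.
rewrite qexprDn => [|]; last first.
  rewrite !tensM taft_gx mulr1 mul1r.
  exact: linear_scale (tens_linearl _) _ _.
by rewrite !tensX taft_xn tens0l tens0r addr0.
Qed.

Fact taft_comul_gn : taft_comul_g ^+ n = 1.
Proof. by rewrite tensX taft_gn. Qed.

Fact taft_comul_gx :
  taft_comul_g * taft_comul_x = w *: (taft_comul_x * taft_comul_g).
Proof.
rewrite mulrDr mulrDl scalerDr !tensM taft_gx mulr1 mul1r.
by rewrite (linear_scale (tens_linearl _)) (linear_scale (tens_linearr _)).
Qed.

Definition taft_comul : 'AHom(H, HH) :=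
  AHom (taft_lift_ahom taft_comul_xn taft_comul_gn taft_comul_gx).

Fact taft_counit_xn : (0 : k^o) ^+ n = 0.
Proof. by rewrite expr0n -[n]prednK. Qed.

Fact taft_counit_gn : (1 : k^o) ^+ n = 1.
Proof. exact: expr1n. Qed.

Fact taft_counit_gx : (1 : k^o) * 0 = w *: (0 * 1).
Proof. by rewrite mulr0 mul0r scaler0. Qed.

Definition taft_counit : 'AHom(H, k^o) :=
  AHom (taft_lift_ahom taft_counit_xn taft_counit_gn taft_counit_gx).

Definition taft_antipode : 'End(H) :=
  linfun (tsum (fun i j => taft_g^-1 ^+ j * (- (taft_g^-1 * taft_x)) ^+ i)).

Lemma taft_comul_monoE a b :
  taft_comul (mono a b) = taft_comul_x ^+ a * taft_comul_g ^+ b.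
Proof. exact: taft_lift_mono taft_comul_xn taft_comul_gn. Qed.

Lemma taft_comulx : taft_comul taft_x = tens taft_x 1 + tens taft_g taft_x.
Proof. by rewrite taft_comul_monoE mulr1. Qed.

Lemma taft_comulg : taft_comul taft_g = tens taft_g taft_g.
Proof. by rewrite taft_comul_monoE mul1r. Qed.

Lemma taft_counitx : taft_counit taft_x = 0.
Proof.
by rewrite (taft_lift_mono _ _ taft_counit_xn taft_counit_gn) expr1 mul0r.
Qed.

Lemma taft_counitg : taft_counit taft_g = 1.
Proof.
by rewrite (taft_lift_mono _ _ taft_counit_xn taft_counit_gn) expr1 mul1r.
Qed.

Lemma taft_antipode_mono a b : taft_antipode (mono a b) =
  taft_g^-1 ^+ b * (- (taft_g^-1 * taft_x)) ^+ a.
Proof.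
rewrite lfunE /=; have [na|an] := leqP n a; last first.
  rewrite tsum_mono // expr_mod //.
  by rewrite exprVn taft_gn invr1.
rewrite mono_ge // linear0 -(subnK na) exprD.
suff -> : (- (taft_g^-1 * taft_x)) ^+ n = 0 by rewrite !mulr0.
have XE m : exists c, (- (taft_g^-1 * taft_x)) ^+ m =
    c *: mono m (n.-1 * m).
  elim: m => [|m [c IH]]; first by exists 1; rewrite muln0 scale1r.
  rewrite exprS IH taft_gV taft_gX monoM.
  rewrite -scaleNr -scalerAr -scalerAl monoM !scalerA add0n addn0 add1n muln1 -(mulnS _ m).
  by eexists.
by have [c ->] := XE n; rewrite mono_ge ?scaler0.
Qed.

Lemma taft_antipodex : taft_antipode taft_x = - (taft_g^-1 * taft_x).
Proof. by rewrite taft_antipode_mono mul1r. Qed.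

Lemma taft_antipodeg : taft_antipode taft_g = taft_g^-1.
Proof. by rewrite taft_antipode_mono mulr1. Qed.

Lemma taft_antipode1 : taft_antipode 1 = 1.
Proof. by rewrite (taft_antipode_mono 0 0) mulr1. Qed.

Lemma taft_antipodeM u v :
  taft_antipode (u * v) = taft_antipode v * taft_antipode u.
Proof.
move: u; apply: taft_ext => [z s s'|z s s'|a b _ _].
- by rewrite mulrDl -scalerAl linearP.
- by rewrite linearP mulrDr -scalerAr.
move: v; apply: taft_ext => [z t t'|z t t'|c d _ _].
- by rewrite mulrDr -scalerAr linearP.
- by rewrite linearP mulrDl -scalerAl.
rewrite monoM linearZ /= !taft_antipode_mono !mulrA -(mulrA (_ ^+ d)).
set X := - _; set G := taft_g^-1.
have XG : X * G = w *: (G * X).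
  have gX : taft_g * X = - taft_x.
    by rewrite /X mulrN mulrA mulrV ?taft_g_unit // mul1r.
  apply: (mulrI taft_g_unit); rewrite -scalerAr (mulrA _ X) gX.
  rewrite (mulrA _ G) mulrV ?taft_g_unit // mul1r.
  apply: (mulrI taft_g_unit).
  by rewrite mulNr mulrN mulrA taft_gxg -scalerAr gX scalerN.
have -> : X ^+ c * G ^+ b = w ^+ (b * c) *: (G ^+ b * X ^+ c).
  by rewrite (qcommX XG) mulnC.
by rewrite -scalerAr -scalerAl mulrA -exprD -!mulrA -exprD addnC [(c + a)%N]addnC.
Qed.

Fact taft_comulA h :
  tlift (fun a b => tens (taft_comul a) b) (taft_comul h) =
  tlift (fun a b => tlift (fun c d => tens (tens a c) d) (taft_comul b))
    (taft_comul h) :> tensor (tensor H H) H.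
Proof.
set F := fun a b : H => tens (taft_comul a) b.
set K := fun a c d : H => tens (tens a c) d : tensor (tensor H H) H.
rewrite -/(fun a b => tlift (K a) (taft_comul b)).
set L := fun a b => tlift (K a) (taft_comul b).
have Fl b : linear (F^~ b) by move=> z u v; rewrite /F linearP tens_linearl.
have Fr a : linear (F a) by move=> z u v; rewrite /F linearP.
have Kl d : forall c, linear (fun a => K a c d).
  by move=> c z u v; rewrite /K !tens_linearl.
have Km a d : linear (fun c => K a c d).
  by move=> z u v; rewrite /K linearP tens_linearl.
have Kr a c : linear (K a c) by move=> z u v; rewrite /K linearP.
have KT a c d : tlift (K a) (tens c d) = tens (tens a c) d.
  by rewrite tlift_tens.
have Ll b : linear (L^~ b) by apply: tlift_linearF.
have Lr a : linear (L a) by move=> z u v; rewrite /L !linearP.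
have FM a b c d : F (a * c) (b * d) = F a b * F c d.
  by rewrite /F ahomM tensM.
have LM a b c d : L (a * c) (b * d) = L a b * L c d.
  rewrite /L ahomM; move: (taft_comul b) (taft_comul d) => s t.
  move: s; apply: tensor_ext => [z s s'|z s s'|e f].
  - by rewrite mulrDl -scalerAl linearP.
  - by rewrite linearP mulrDl -scalerAl.
  move: t; apply: tensor_ext => [z t t'|z t t'|e' f'].
  - by rewrite mulrDr -scalerAr linearP.
  - by rewrite linearP mulrDr -scalerAr.
  by rewrite tensM !KT !tensM.
have L1 : L 1 1 = 1 by rewrite /L rmorph1 -tens1 KT.
move: h; apply: taft_gen_ind => [c u v IHu IHv|u v IHu IHv|||].
- by rewrite !linearP /= IHu IHv.
- by rewrite ahomM (tliftM Fl Fr FM) (tliftM Ll Lr LM) IHu IHv.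
- by rewrite rmorph1 -tens1 !tlift_tens // L1 /F rmorph1 tens1.
- rewrite taft_comulx !raddfD /= !tlift_tens //.
  rewrite /F /L taft_comulx taft_comulg rmorph1 raddfD /= -tens1 !KT.
  have := tens_linearl (1 : H) 1 (tens taft_x 1 : HH) (tens taft_g taft_x).
  by rewrite !scale1r => ->; rewrite addrA.
by rewrite taft_comulg !tlift_tens // /F /L taft_comulg KT.
Qed.

Fact taft_counitl h : tlift (fun a b => taft_counit a *: b) (taft_comul h) = h.
Proof.
set F := fun a b : H => (taft_counit a : k) *: b.
have Fl b : linear (F^~ b).
  by move=> z u v; rewrite /F linearP scalerDl scalerA.
have Fr a : linear (F a) by move=> z u v; rewrite /F scalerDr !scalerA mulrC.
have FM a b c d : F (a * c) (b * d) = F a b * F c d.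
  by rewrite /F ahomM -scalerAl -scalerAr scalerA.
move: h; apply: taft_gen_ind => [c u v IHu IHv|u v IHu IHv|||].
- by rewrite !linearP /= IHu IHv.
- by rewrite ahomM (tliftM Fl Fr FM) IHu IHv.
- by rewrite rmorph1 -tens1 tlift_tens // /F rmorph1 scale1r.
- rewrite taft_comulx raddfD /= !tlift_tens // /F taft_counitx taft_counitg.
  by rewrite scale0r scale1r add0r.
by rewrite taft_comulg tlift_tens // /F taft_counitg scale1r.
Qed.

Fact taft_counitr h : tlift (fun a b => taft_counit b *: a) (taft_comul h) = h.
Proof.
set F := fun a b : H => (taft_counit b : k) *: a.
have Fl b : linear (F^~ b).
  by move=> z u v; rewrite /F scalerDr !scalerA mulrC.
have Fr a : linear (F a).
  by move=> z u v; rewrite /F linearP scalerDl scalerA.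
have FM a b c d : F (a * c) (b * d) = F a b * F c d.
  by rewrite /F ahomM -scalerAl -scalerAr scalerA.
move: h; apply: taft_gen_ind => [c u v IHu IHv|u v IHu IHv|||].
- by rewrite !linearP /= IHu IHv.
- by rewrite ahomM (tliftM Fl Fr FM) IHu IHv.
- by rewrite rmorph1 -tens1 tlift_tens // /F rmorph1 scale1r.
- rewrite taft_comulx raddfD /= !tlift_tens // /F taft_counitx rmorph1.
  by rewrite scale0r scale1r addr0.
by rewrite taft_comulg tlift_tens // /F taft_counitg scale1r.
Qed.

Fact taft_antipodel h :
  tlift (fun a b => taft_antipode a * b) (taft_comul h) = (taft_counit h)%:A.
Proof.
set F := fun a b : H => taft_antipode a * b.
have Fl b : linear (F^~ b).
  by move=> z u v; rewrite /F linearP mulrDl scalerAl.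
have Fr a : linear (F a) by move=> z u v; rewrite /F mulrDr scalerAr.
have FM (c : k) s t : tlift F s = c%:A -> tlift F (s * t) = c *: tlift F t.
  move=> Fs; move: t; apply: tensor_ext => [z t t'|z t t'|a b].
  - by rewrite mulrDr -scalerAr linearP.
  - by rewrite linearP scalerDr !scalerA mulrC.
  rewrite tlift_tens //.
  have -> : tlift F (s * tens a b) = taft_antipode a * tlift F s * b.
    move: s {Fs}; apply: tensor_ext => [z s s'|z s s'|a' b'].
    - by rewrite mulrDl -scalerAl linearP.
    - by rewrite linearP mulrDr mulrDl -scalerAr -scalerAl.
    by rewrite tensM !tlift_tens // /F taft_antipodeM !mulrA.
  by rewrite Fs -scalerAr mulr1 -scalerAl.
move: h; apply: taft_gen_ind => [c u v IHu IHv|u v IHu IHv|||].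
- by rewrite !linearP /= IHu IHv scalerDl scalerA.
- by rewrite !ahomM (FM _ _ _ IHu) IHv scalerA.
- by rewrite !rmorph1 -tens1 tlift_tens // /F taft_antipode1 mulr1 scale1r.
- rewrite taft_comulx raddfD /= !tlift_tens // /F taft_counitx scale0r.
  by rewrite taft_antipodex taft_antipodeg mulr1 addNr.
rewrite taft_comulg tlift_tens // /F taft_antipodeg taft_counitg scale1r.
by rewrite mulVr ?taft_g_unit.
Qed.

Fact taft_antipoder h :
  tlift (fun a b => a * taft_antipode b) (taft_comul h) = (taft_counit h)%:A.
Proof.
set F := fun a b : H => a * taft_antipode b.
have Fl b : linear (F^~ b) by move=> z u v; rewrite /F mulrDl scalerAl.
have Fr a : linear (F a).
  by move=> z u v; rewrite /F linearP mulrDr scalerAr.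
have FM (c : k) s t : tlift F t = c%:A -> tlift F (s * t) = c *: tlift F s.
  move=> Ft; move: s; apply: tensor_ext => [z s s'|z s s'|a b].
  - by rewrite mulrDl -scalerAl linearP.
  - by rewrite linearP scalerDr !scalerA mulrC.
  rewrite tlift_tens //.
  have -> : tlift F (tens a b * t) = a * tlift F t * taft_antipode b.
    move: t {Ft}; apply: tensor_ext => [z s s'|z s s'|a' b'].
    - by rewrite mulrDr -scalerAr linearP.
    - by rewrite linearP mulrDr mulrDl -scalerAr -scalerAl.
    by rewrite tensM !tlift_tens // /F taft_antipodeM !mulrA.
  by rewrite Ft -scalerAr mulr1 -scalerAl.
move: h; apply: taft_gen_ind => [c u v IHu IHv|u v IHu IHv|||].
- by rewrite !linearP /= IHu IHv scalerDl scalerA.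
- by rewrite !ahomM (FM _ _ _ IHv) IHu scalerA mulrC.
- by rewrite !rmorph1 -tens1 tlift_tens // /F taft_antipode1 mulr1 scale1r.
- rewrite taft_comulx raddfD /= !tlift_tens // /F taft_counitx scale0r.
  rewrite taft_antipodex taft_antipode1 mulr1 mulrN mulrA.
  by rewrite mulrV ?taft_g_unit // mul1r subrr.
rewrite taft_comulg tlift_tens // /F taft_antipodeg taft_counitg scale1r.
by rewrite mulrV ?taft_g_unit.
Qed.

Definition taft_hopf : hopf H :=
  Hopf taft_comulA taft_counitl taft_counitr taft_antipodel taft_antipoder.

End TaftAlgebra.

Section Orbits.
Variables (k : fieldType) (A : falgType k) (S : hopf A).
Local Open Scope classical_set_scope.

Definition left_coideal_subalgebra : set {vspace A} :=
  [set N : {vspace A} | [/\ 1 \in N, (N * N <= N)%VS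
             & (comul S @: N <= tensv fullv N)%VS]].

Definition hopf_aut : set 'AEnd(A) :=
  [set f : 'AEnd(A) | [/\ bijective f,
    forall h, comul S (f h) = tlift (fun a b => tens (f a) (f b)) (comul S h),
    forall h, counit S (f h) = counit S h
    & forall h, antipode S (f h) = f (antipode S h)]].

Definition hopf_orbit (N : {vspace A}) : set {vspace A} :=
  [set (f @: N)%VS | f in hopf_aut].

Definition coideal_orbits : set (set {vspace A}) :=
  [set hopf_orbit N | N in left_coideal_subalgebra].

End Orbits.

Section TaftSubalgebras.
Variables (k : fieldType) (n : nat) (w : k) (hw : n.-primitive_root w).
Local Notation H := (taft hw).

(* k<g^d>: the span of the subgroup generated by g^d, whose elements are the
   (g^d)^j with j < n because g^n = 1 *)
Definition taft_grp (d : nat) : {vspace H} :=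
  <<[seq ((taft_g hw ^+ d) ^+ j)%R | j <- iota 0 n]>>%VS.

(* agenv is the unital subalgebra generated by a subspace. *)
Definition taft_grpx (d : nat) : {vspace H} :=
  agenv <<[:: (taft_g hw ^+ d)%R; taft_x hw]>>%VS.

Definition taft_beta (beta : k) : {vspace H} :=
  agenv <[(taft_g hw + beta *: taft_x hw)%R]>%VS.

End TaftSubalgebras.

(* Main.v *)
Require Import Defs.
From HB Require Import structures.
From mathcomp Require Import all_boot all_order all_algebra all_field.
From mathcomp Require Import classical_sets.

Set Implicit Arguments.
Unset Strict Implicit.
Unset Printing Implicit Defensive.

Import GRing.Theory.
Local Open Scope ring_scope.

(** The coproduct of x^a g^b only involves the right factors x^i g^b with
    i <= a, so a left coideal N is stable under the maps (phi (x) id) Delta,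
    for phi a linear form (the slices below), and these maps can be used to
    strip leading terms.  If h in N has x-degree m and its coefficient at
    x^m g^j is nonzero, the form dual to x^m g^j shows that N contains g^j
    ([lcs_top]); if m > 0, the form dual to x^(m-1) g^(j+1) yields a combination
    of x g^j and g^(j+1) with a nonzero coefficient at x g^j, because the
    q-binomial coefficient [m choose m-1] does not vanish for m < n
    ([lcs_subtop]).  As N is an algebra it then contains x + c g for some c.

    So either N contains some x + c g, or all its elements have x-degree 0.
    Dividing by leading terms ([lcs_generated]), N is spanned by the products
    (x + c g)^m g^j with g^j in N in the first case, and by the g^j in N in the
    second.  The exponents j with g^j in N are the multiples of a divisor d of
    n.  This gives k<g^d> and, if x is in N, N_(d,x).  In the remaining case
    conjugating x + c g by g^j produces w^j x + c g, hence (w^j - 1) x in N, so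
    that only j = 0 is possible and N = N_beta with beta = 1/c ([lcs_cases]).

    The same slices determine the Hopf automorphisms f: the grouplike f(g) is
    equal to its own leading power of g, the skew-primitive f(x) has x-degree 1,
    and the commutation rule of g and x leaves only f(g) = g and f(x) = c x with
    c nonzero ([hopf_aut_diag]).  All these maps are automorphisms
    ([taft_scale_hopf_aut]); they fix every subalgebra of the first two
    families and send N_beta to N_(beta c), which gives the orbits.

    To tell the subalgebras apart one uses algebra automorphisms that scale x
    and g: their fixed points form a subalgebra, so it suffices to look at
    generators.  N_beta differs from N_(d,x) because it is commutative. *)

(** * Coefficients and x-degree *)

Section Coefficients.
Variables (k : fieldType) (n : nat) (w : k) (hw : n.-primitive_root w).
Local Notation H := (taft hw).
Local Notation x := (taft_x hw).
Local Notation g := (taft_g hw).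
Implicit Types (h : H) (a b m j : nat).

Let n_gt0 : (0 < n)%N. Proof. exact: prim_order_gt0 hw. Qed.

(** The second exponent is read modulo n, as in [mono]; the first is not, so
    that coefficients beyond x^(n-1) are zero. *)
Definition coef a b h : k^o :=
  tsum (fun i j => ((i == a) && (j == b %% n)%N)%:R : k^o) h.

HB.instance Definition _ a b := GRing.isLinear.Build k H k^o *:%R (coef a b)
  (tsum_linear (fun i j => ((i == a) && (j == b %% n)%N)%:R : k^o)).

Lemma coef_mono a b c d : (c < n)%N ->
  coef a b (mono hw c d) = ((c == a) && (d == b %[mod n]))%:R.
Proof. by move=> cn; rewrite /coef tsum_mono. Qed.

Lemma coef_mod a b h : coef a (b %% n) h = coef a b h.
Proof. by rewrite /coef modn_mod. Qed.

Lemma coef_ord (i j : 'I_n) h : coef i j h = (h : 'M[k]_n) i j.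
Proof.
rewrite /coef /tsum (bigD1 i) //= (bigD1 j) //= !big1 => [|p pi|p pj].
- by rewrite !addr0 modn_small // !eqxx [_ *: _]mulr1.
- rewrite big1 // => q _.
  by rewrite (negPf pi : (p == i :> nat) = false) scaler0.
by rewrite modn_small // (negPf pj : (p == j :> nat) = false) andbF scaler0.
Qed.

Lemma coef_ge a b h : (n <= a)%N -> coef a b h = 0.
Proof.
move=> na; rewrite /coef /tsum big1 // => i _; rewrite big1 // => j _.
by rewrite ltn_eqF ?scaler0 // (leq_trans _ na).
Qed.

Lemma taft_coefE h : h = \sum_(i < n) \sum_(j < n) coef i j h *: mono hw i j.
Proof.
rewrite {1}(taftE h); apply: eq_bigr => i _; apply: eq_bigr => j _.
by rewrite coef_ord.
Qed.

Definition xdeg_le m h := forall a b, (m < a)%N -> coef a b h = 0.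

(** Identities that are linear in h and hold only up to x-degree m can thus be
    checked on monomials. *)
Lemma xdeg_le_ext (C : lmodType k) (f f' : H -> C) m h :
    linear f -> linear f' ->
    (forall a b, (a <= m)%N -> (a < n)%N ->
       f (mono hw a b) = f' (mono hw a b)) ->
  xdeg_le m h -> f h = f' h.
Proof.
move=> fP fP' ff' hm.
pose Fl := GRing.isLinear.Build k H C *:%R f fP.
pose fl : {linear H -> C} := HB.pack f Fl.
pose Fl' := GRing.isLinear.Build k H C *:%R f' fP'.
pose fl' : {linear H -> C} := HB.pack f' Fl'.
rewrite -[f h]/(fl h) -[f' h]/(fl' h) (taft_coefE h) !linear_sum.
apply: eq_bigr => i _; rewrite !linear_sum; apply: eq_bigr => j _.
rewrite !linearZ /=; have [im|mi] := leqP i m; first by rewrite ff'.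
by rewrite hm // !scale0r.
Qed.

Lemma xdeg_le_nonzero h : h != 0 ->
  exists m j, [/\ xdeg_le m h, (m < n)%N & coef m j h != 0].
Proof.
move=> h0; pose P m := [exists i : 'I_n, [exists j : 'I_n,
  (i == m :> nat) && (coef i j h != 0)]].
have exP : exists m, P m.
  have [i /existsP[j hij]|h00] :=
      pickP (fun i : 'I_n => [exists j : 'I_n, coef i j h != 0]).
    by exists i; apply/existsP; exists i; apply/existsP; exists j; rewrite eqxx.
  case/eqP: h0; rewrite (taft_coefE h) big1 // => i _; rewrite big1 // => j _.
  by have /existsPn/(_ j)/negPn/eqP-> := negbT (h00 i); rewrite scale0r.
have ubP m : P m -> (m <= n)%N.
  by case/existsP=> i /existsP[j /andP[/eqP<- _]]; apply: ltnW.
case: (ex_maxnP exP ubP) => m /existsP[i /existsP[j /andP[/eqP im hij]]] maxm.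
exists m, j; rewrite -im; split=> // a b ma; have [na|an] := leqP n a.
  exact: coef_ge.
apply/eqP; apply: contraTT ma => hab; rewrite -leqNgt im maxm //.
apply/existsP; exists (Ordinal an); apply/existsP.
exists (Ordinal (ltn_pmod b n_gt0)); by rewrite /= eqxx coef_mod.
Qed.

Lemma mono_neq0 a b : (a < n)%N -> mono hw a b != 0.
Proof.
move=> an; apply/eqP=> /(congr1 (coef a b)) /eqP.
by rewrite coef_mono // !eqxx linear0 oner_eq0.
Qed.

Lemma coef_mulg a b j h : coef a (b + j) (h * g ^+ j) = coef a b h.
Proof.
apply: (@xdeg_le_ext k^o (fun h => coef a (b + j) (h * g ^+ j)) _ n)
  => [c u v|c u v|c d _ cn|i e ni].
- by rewrite mulrDl -scalerAl linearP.
- by rewrite linearP.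
- rewrite taft_gX monoM muln0 scale1r addn0 !coef_mono //.
  by rewrite eqn_modDr.
by rewrite coef_ge // ltnW.
Qed.

(** The power of w comes from moving g^j past x^a. *)
Lemma coef_gmul a b j h :
  coef a (b + j) (g ^+ j * h) = w ^+ (j * a) * coef a b h.
Proof.
apply: (@xdeg_le_ext k^o (fun h => coef a (b + j) (g ^+ j * h))
  (fun h => w ^+ (j * a) * coef a b h) n) => [c u v|c u v|c d _ cn|i e ni].
- by rewrite mulrDr -scalerAr linearP.
- by rewrite linearP mulrDr [in RHS]scalerAr.
- rewrite taft_gX monoM add0n [(j + d)%N]addnC linearZ /= !coef_mono //.
  rewrite eqn_modDr; have [->|_] := eqVneq c a; first by [].
  by rewrite scaler0 mulr0.
by rewrite coef_ge // ltnW.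
Qed.

End Coefficients.

(** * Slices of the coproduct *)

Section Slices.
Variables (k : fieldType) (n : nat) (w : k) (hw : n.-primitive_root w).
Local Notation H := (taft hw).
Local Notation x := (taft_x hw).
Local Notation g := (taft_g hw).
Local Notation coef := (@coef k n w hw).
Implicit Types (h : H) (a b m j : nat) (phi : {linear H -> k^o}).

Definition lslice phi (t : tensor H H) : H :=
  tlift (fun u v => (phi u : k) *: v) t.

HB.instance Definition _ phi := GRing.isLinear.Build k (tensor H H) H *:%R
  (lslice phi) (tlift_linear _).

Lemma lslice_tens phi u v : lslice phi (tens u v) = (phi u : k) *: v.
Proof.
rewrite /lslice tlift_tens // => [v'|u'] c s t.
  by rewrite linearP scalerDl scalerA.
by rewrite scalerDr !scalerA mulrC.
Qed.

Definition slice phi h : H := lslice phi (comul (taft_hopf hw) h).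

Lemma slice_linear phi : linear (slice phi).
Proof. by move=> c u v; rewrite /slice !linearP. Qed.

(** The two summands of the coproduct of x commute up to w, so its powers are
    given by the q-binomial formula. *)
Lemma slice_mono phi a b : slice phi (mono hw a b) =
  \sum_(i < a.+1)
    (qbin w a i * phi (mono hw i (a - i + b))) *: mono hw (a - i) b.
Proof.
rewrite /slice /= taft_comul_monoE /taft_comul_x (qexprD (w := w)); last first.
  rewrite !tensM taft_gx mulr1 mul1r.
  exact: linear_scale (tens_linearl _) _ _.
rewrite mulr_suml linear_sum; apply: eq_bigr => i _.
rewrite -scalerAl linearZ /= !tensX !tensM expr1n mul1r lslice_tens scalerA.
by rewrite -mulrA -exprD -!monoE.
Qed.

Lemma slice_coef_mono m j a b : (a < n)%N -> slice (coef m j) (mono hw a b) =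
  if (m <= a)%N && (a - m + b == j %[mod n]) then
    qbin w a m *: mono hw (a - m) b else 0.
Proof.
move=> an; rewrite slice_mono.
have E (i : 'I_a.+1) : i != m :> nat ->
    (qbin w a i * coef m j (mono hw i (a - i + b))) *: mono hw (a - i) b = 0.
  move=> im; rewrite coef_mono ?(leq_trans _ an) //.
  by rewrite (negPf im) mulr0 scale0r.
have [ma|am] /= := leqP m a; last first.
  by rewrite big1 // => i _; rewrite E // ltn_eqF // (leq_trans (ltn_ord i)).
rewrite (bigD1 (Ordinal (ma : m < a.+1)%N)) //= big1 ?addr0; last first.
  by move=> i im; rewrite E.
rewrite coef_mono ?(leq_ltn_trans ma) // eqxx.
by case: ifP => _; rewrite ?mulr1 // mulr0 scale0r.
Qed.

(** The form dual to x^m g^j meets only the first factor of x^m g^j (x) g^j,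
    the term of maximal x-degree on the left. *)
Lemma slice_top m j h : xdeg_le m h ->
  slice (coef m j) h = (coef m j h : k) *: g ^+ j.
Proof.
apply: (@xdeg_le_ext _ _ _ hw H (slice (coef m j))
  (fun h => (coef m j h : k) *: g ^+ j)) => [|c u v|a b am an].
- exact: slice_linear.
- by rewrite linearP scalerDl scalerA.
rewrite slice_coef_mono // coef_mono // [a == m]eqn_leq am /=.
case: leqP => ma /=; last by rewrite scale0r.
have -> : a = m by apply/eqP; rewrite eqn_leq am.
rewrite subnn add0n qbinn scale1r taft_gX -[mono hw 0 b]mono_mod.
by case: eqP => [->|_]; rewrite ?mono_mod ?scale1r ?scale0r.
Qed.

(** On x^(m+1) g^j one now has to put one x in the right factor; the terms
    x^m g^(j+1) contribute as in [slice_top]. *)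
Lemma slice_subtop m j h : xdeg_le m.+1 h ->
  slice (coef m j.+1) h = (qbin w m.+1 m * coef m.+1 j h) *: (x * g ^+ j)
     + (coef m j.+1 h : k) *: g ^+ j.+1.
Proof.
apply: (@xdeg_le_ext _ _ _ hw H (slice (coef m j.+1)) (fun h =>
  (qbin w m.+1 m * coef m.+1 j h) *: (x * g ^+ j)
     + (coef m j.+1 h : k) *: g ^+ j.+1)) => [|c u v|a b am an].
- exact: slice_linear.
- rewrite !(linearP (coef _ _)); move: (qbin w m.+1 m) => q.
  rewrite -[LHS]/((q * (c * coef m.+1 j u + coef m.+1 j v)) *: (x * g ^+ j)
    + (c * coef m j.+1 u + coef m j.+1 v) *: g ^+ j.+1).
  by rewrite mulrDr !scalerDl addrACA scalerDr !scalerA mulrCA.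
rewrite slice_coef_mono // !coef_mono //.
case: ltngtP => /= [ma|am'|<-].
- have -> : a = m.+1 by apply/eqP; rewrite eqn_leq am.
  rewrite eqxx subSnn add1n -[b.+1]addn1 -[j.+1]addn1 eqn_modDr scale0r addr0.
  case: eqP => [bj|_]; last by rewrite mulr0 scale0r.
  rewrite mulr1 taft_gX monoM mul0n scale1r add0n addn0.
  by rewrite -(mono_mod _ _ b) bj mono_mod.
- by rewrite (ltn_eqF (leqW am')) mulr0 !scale0r addr0.
rewrite subnn add0n qbinn scale1r (ltn_eqF (ltnSn m)) mulr0 scale0r.
rewrite add0r taft_gX.
rewrite -(mono_mod _ _ b).
by case: eqP => [->|_]; rewrite ?mono_mod ?scale1r ?scale0r.
Qed.

(** By the product formula, q-binomial coefficients can only vanish through a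
    factor w^l - 1 with l a multiple of n, and here 1 < l < n. *)
Lemma qbin_subtop_neq0 m : (m.+1 < n)%N -> qbin w m.+1 m != 0.
Proof.
move=> mn; have: qbin w m.+1 m * \prod_(l < m) (w ^+ l.+1 - 1) != 0.
  rewrite qbinE; apply/prodf_neq0 => l _; rewrite subr_eq0 -(prim_order_dvd hw).
  have lm := ltn_ord l; rewrite gtnNdvd ?subn_gt0 ?ltnS //; first exact: ltnW.
  exact: leq_ltn_trans (leq_subr _ _) mn.
by rewrite mulf_eq0 => /norP[].
Qed.

End Slices.

(** * Generated subalgebras and subalgebras of tensor products *)

Section Subalgebras.
Variables (k : fieldType) (A : falgType k).
Implicit Types (U V N : {vspace A}) (S : hopf A).

Lemma subalgM N u v : (N * N <= N)%VS -> u \in N -> v \in N -> u * v \in N.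
Proof. by move=> /prodvP NN; apply: NN. Qed.

Lemma subalgX N u m : 1 \in N -> (N * N <= N)%VS -> u \in N -> u ^+ m \in N.
Proof.
by move=> N1 NN Nu; elim: m => // m IH; rewrite exprS; apply: subalgM.
Qed.

Lemma mem1_agenv U : 1 \in agenv U.
Proof. by rewrite memvE sub1_agenv. Qed.

Lemma agenv_min U N : 1 \in N -> (N * N <= N)%VS -> (U <= N)%VS ->
  (agenv U <= N)%VS.
Proof.
move=> N1 NN UN; rewrite agenv_sub_modl -?memvE //.
exact: subv_trans (prodvSl _ UN) NN.
Qed.

Lemma line_scale (c : k) (v : A) : c != 0 -> (<[c *: v]> = <[v]>)%VS.
Proof.
move=> c0; apply/subv_anti/andP; split; rewrite -memvE.
  exact/memvZ/memv_line.
by rewrite -[v in v \in _](scalerK c0) memvZ // memv_line.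
Qed.

(** The centraliser of u is a subalgebra containing u, so everything generated
    by u commutes with u; the same argument applied to the centraliser of such
    an element gives the commutation of any two of them. *)
Lemma agenv_line_comm (u : A) : {in agenv <[u]> &, forall v t, v * t = t * v}.
Proof.
have sub_cent s : u \in 'C[s]%VS -> (agenv <[u]> <= 'C[s])%VS.
  move=> us; apply: agenv_min; rewrite ?cent1v1 -?memvE //.
  by rewrite [X in (X <= _)%VS](prodv_id [aspace of 'C[s]%VS]).
move=> v t v_u t_u; apply/cent1vP.
apply: (subvP (sub_cent _ _)) v_u; rewrite cent1vC.
by apply: (subvP (sub_cent _ _)) t_u; apply: cent1v_id.
Qed.

Lemma agenv_fixed (f : 'AEnd(A)) U :
  {in U, forall u, f u = u} -> {in agenv U, forall u, f u = u}.
Proof.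
move=> fU u; move: u.
have fixE v : f v = v -> v \in fixedSpace f by move/fixedSpaceP.
suff sub : (agenv U <= fixedSpace f)%VS by move=> u /(subvP sub)/fixedSpaceP.
apply: agenv_min; first by apply: fixE; rewrite rmorph1.
  apply/prodvP=> u v /fixedSpaceP fu /fixedSpaceP fv.
  by apply: fixE; rewrite ahomM fu fv.
by apply/subvP=> u /fU/fixE.
Qed.

Lemma span_fixed (f : 'AEnd(A)) (s : seq A) :
  {in s, forall u, f u = u} -> {in <<s>>%VS, forall u, f u = u}.
Proof.
move=> fs u us; apply/fixedSpaceP; apply: (subvP _ _ us).
by apply/span_subvP=> v /fs/fixedSpaceP.
Qed.

End Subalgebras.

Section TensorSubalgebras.
Variables (k : fieldType) (A : falgType k).
Implicit Types (U V : {vspace A}) (S : hopf A).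

Lemma tensv_mul (B : falgType k) U (V : {vspace B}) :
    (U * U <= U)%VS -> (V * V <= V)%VS ->
  (tensv U V * tensv U V <= tensv U V)%VS.
Proof.
move=> UU VV.
have tensl a b t : a \in U -> b \in V -> t \in tensv U V ->
    tens a b * t \in tensv U V.
  move=> Ua Vb.
  suff/subvP sub: (tensv U V <= amull (tens a b) @^-1: tensv U V)%VS.
    by move/sub; rewrite -memv_preim lfunE.
  apply/tensvP=> c d Uc Vd; rewrite -memv_preim lfunE /= tensM.
  by apply: memv_tens; [apply: (prodvP UU) | apply: (prodvP VV)].
apply/prodvP=> s t + tUV.
suff/subvP sub: (tensv U V <= amulr t @^-1: tensv U V)%VS.
  by move/sub; rewrite -memv_preim lfunE.
by apply/tensvP=> a b Ua Vb; rewrite -memv_preim lfunE /= tensl.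
Qed.

(** The coproduct is multiplicative, so the coideal condition need only be
    checked on generators. *)
Lemma agenv_left_coideal S U :
    (comul S @: U <= tensv fullv (agenv U))%VS ->
  left_coideal_subalgebra S (agenv U).
Proof.
move=> SU; split; [exact: mem1_agenv | by rewrite agenvM |].
rewrite aimg_agen; apply: agenv_min => //.
  by rewrite -tens1 memv_tens ?memvf ?mem1_agenv.
by apply: tensv_mul; [apply: subvf | rewrite agenvM].
Qed.

End TensorSubalgebras.

(** * Classification of the left coideal subalgebras *)

Section Classification.
Variables (k : fieldType) (n : nat) (w : k) (hw : n.-primitive_root w).
Local Notation H := (taft hw).
Local Notation x := (taft_x hw).
Local Notation g := (taft_g hw).
Local Notation coef := (@coef k n w hw).
Local Notation lcs := (left_coideal_subalgebra (taft_hopf hw)).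
Implicit Types (h : H) (a b m j d : nat) (N M : {vspace H}).

Let n_gt0 : (0 < n)%N. Proof. exact: prim_order_gt0 hw. Qed.

Lemma lcs_slice N (phi : {linear H -> k^o}) h :
  lcs N -> h \in N -> slice phi h \in N.
Proof.
case=> _ _ NT /(memv_img (comul (taft_hopf hw))) /(subvP NT).
suff/subvP sub: (tensv fullv N <= linfun (lslice phi) @^-1: N)%VS.
  by move/sub; rewrite -memv_preim lfunE.
by apply/tensvP=> u v _ Nv; rewrite -memv_preim lfunE /= lslice_tens memvZ.
Qed.

Lemma lcs_top N m j h : lcs N -> xdeg_le m h -> h \in N -> coef m j h != 0 ->
  g ^+ j \in N.
Proof.
move=> lN hm Nh hj; have := lcs_slice (coef m j) lN Nh.
by rewrite (slice_top _ hm) rpredZeq (negPf hj).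
Qed.

Lemma gV_exp j : g ^+ j * g ^+ (n.-1 * j) = 1.
Proof. by rewrite -exprD -mulSn prednK // exprM taft_gn expr1n. Qed.

Lemma lcs_subtop N m j h : lcs N -> xdeg_le m.+1 h -> h \in N ->
  coef m.+1 j h != 0 -> exists c : k, x + c *: g \in N.
Proof.
move=> lN hm Nh hj; have Ngj := lcs_top lN hm Nh hj.
have [N1 NN _] := lN; have := lcs_slice (coef m j.+1) lN Nh.
rewrite (slice_subtop _ hm).
have q0 : qbin w m.+1 m * coef m.+1 j h != 0.
  rewrite mulf_neq0 // (qbin_subtop_neq0 hw) // ltnNge.
  by apply: contraNN hj => nm; rewrite coef_ge.
set q : k := _ * coef _ _ _ in q0 *; set c : k := coef m _ h => Nxg.
exists (q^-1 * c).
have -> : x + (q^-1 * c) *: g =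
    q^-1 *: ((q *: (x * g ^+ j) + c *: g ^+ j.+1) * g ^+ j ^+ n.-1).
  rewrite -exprM mulnC mulrDl -!scalerAl exprS -!mulrA !gV_exp !mulr1.
  by rewrite scalerDr !scalerA mulVf // scale1r.
by rewrite memvZ // subalgM // subalgX.
Qed.

(** Division by leading terms: subtracting from an element of N the multiples
    of the e m j that match its top coefficients lowers its x-degree.  The
    element h is among the hypotheses so that, when N has no element of degree
    m > 0, the requirement on the e m j is void. *)
Lemma lcs_generated N M (e : nat -> nat -> H) :
    (forall h m j, xdeg_le m h -> h \in N -> coef m j h != 0 ->
      [/\ e m j \in N, e m j \in M & forall a b, (m <= a)%N ->
        coef a b (e m j) = ((a == m) && (b == j %[mod n]))%:R]) ->
  (N <= M)%VS.
Proof.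
move=> eP; suff sub m h : (forall a b, (m <= a)%N -> coef a b h = 0) ->
    h \in N -> h \in M.
  by apply/subvP=> h; apply: (sub n) => a b; apply: coef_ge.
elim: m h => [|m IH] h hm Nh.
  rewrite (taft_coefE h) big1 ?mem0v // => i _; rewrite big1 // => j _.
  by rewrite hm // scale0r.
pose s : H := \sum_(j < n | coef m j h != 0) (coef m j h : k) *: e m j.
have {}eP (j : 'I_n) (hj : coef m j h != 0) := eP h m j hm Nh hj.
rewrite -(subrK s h) memvD //; last first.
  by apply: memv_suml => j /eP[_ Me _]; rewrite memvZ.
apply: IH => [a b ma|]; last first.
  by rewrite memvB // memv_suml // => j /eP[Ne _ _]; rewrite memvZ.
have -> : coef a b (h - s) = (coef a b h : k) - \sum_(j < n | coef m j h != 0)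
    coef m j h * ((a == m) && (b == j %[mod n]))%:R.
  rewrite (linearB (coef a b)) (linear_sum (coef a b)).
  apply: (congr1 (fun z : k => coef a b h - z)); apply: eq_bigr => j hj.
  by have [_ _ ce] := eP j hj; rewrite linearZ /= ce.
have [ma'|ne_am] := eqVneq a m; last first.
  rewrite big1 => [|j _]; last by rewrite mulr0.
  by rewrite hm ?subr0 // ltn_neqAle eq_sym ne_am.
rewrite ma' /= -(coef_mod m b); set j := Ordinal (ltn_pmod b n_gt0).
rewrite -[(b %% n)%N]/(val j); apply/eqP; rewrite subr_eq0; apply/eqP.
have E (i : 'I_n) : i != j -> coef m i h * (val j == i %% n)%N%:R = 0.
  by rewrite modn_small // val_eqE eq_sym => /negPf->; rewrite mulr0.
have [j0|nj0] := eqVneq (coef m j h) 0.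
  rewrite j0 big1 // => i i0; apply: E.
  by apply: contraNneq i0 => ->; rewrite j0.
rewrite (bigD1 j) //= big1 => [|i /andP[_ /E] //].
by rewrite modn_mod eqxx mulr1 addr0.
Qed.

(** The factors x and c g commute up to w, and in the q-binomial expansion of
    (x + c g)^m only x^m reaches x-degree m. *)
Lemma coef_affineX (c : k) a b m j : (m < n)%N -> (m <= a)%N ->
  coef a b ((x + c *: g) ^+ m * g ^+ j) = ((a == m) && (b == j %[mod n]))%:R.
Proof.
move=> mn ma; rewrite (qexprD (w := w)); last first.
  by rewrite -scalerAl taft_gx -scalerAr !scalerA mulrC.
rewrite mulr_suml linear_sum big_ord_recr big1 /= => [|i _].
  rewrite qbinn scale1r subnn mulr1 add0r -monoE coef_mono //.
  by rewrite (eq_sym m) (eq_sym (j %% n)%N).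
rewrite exprZn -scalerAl -!scalerAr -scalerAl -mulrA -exprD -monoE !linearZ /=.
rewrite coef_mono ?(leq_trans (ltn_ord i) (ltnW mn)) //.
by rewrite ltn_eqF ?(leq_trans (ltn_ord i)) // !scaler0.
Qed.

Lemma lcs_affine N M (c : k) : lcs N -> x + c *: g \in N ->
    (forall m j, g ^+ j \in N -> (x + c *: g) ^+ m * g ^+ j \in M) ->
  (N <= M)%VS.
Proof.
move=> lN Nx eM; have [N1 NN _] := lN.
apply: (lcs_generated (e := fun m j => (x + c *: g) ^+ m * g ^+ j)).
move=> h m j hm Nh hj; have Ngj := lcs_top lN hm Nh hj.
have mn : (m < n)%N.
  by rewrite ltnNge; apply: contraNN hj => nm; rewrite coef_ge.
split=> [||a b]; [| exact: eM | exact: coef_affineX].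
by rewrite subalgM // subalgX.
Qed.

(** The exponents j with g^j in N form a submonoid of the integers modulo n,
    hence a subgroup. *)
Lemma lcs_grp N : lcs N -> exists2 d, (d %| n)%N &
  forall j, (g ^+ j \in N) = (d %| j)%N.
Proof.
move=> [N1 NN _].
have exd : exists d, (0 < d)%N && (g ^+ d \in N).
  by exists n; rewrite n_gt0 taft_gn.
case: (ex_minnP exd) => d /andP[d0 Nd] dmin.
have gd j : (g ^+ j \in N) = (d %| j)%N.
  apply/idP/idP=> [Nj | /dvdnP[q ->]]; last by rewrite mulnC exprM subalgX.
  have Nr : g ^+ (j %% d) \in N.
    have -> : g ^+ (j %% d) = g ^+ j * g ^+ d ^+ (n.-1 * (j %/ d)).
      rewrite -exprM -exprD [X in _ ^+ (X + _)](divn_eq j d) addnAC.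
      rewrite [(j %/ d * d)%N]mulnC mulnCA -mulSn prednK // exprD exprM.
      by rewrite taft_gn expr1n mul1r.
    by rewrite subalgM // subalgX.
  rewrite /dvdn; apply: contraT; rewrite -lt0n => r0.
  have := dmin (j %% d)%N; rewrite r0 Nr => /(_ isT).
  by rewrite leqNgt ltn_mod d0.
by exists d => //; rewrite -gd taft_gn.
Qed.

Lemma mem_grp d j : g ^+ (d * j) \in taft_grp hw d.
Proof.
have gdn : (g ^+ d) ^+ n = 1 by rewrite -exprM mulnC exprM taft_gn expr1n.
rewrite exprM -(expr_mod j gdn) memv_span //; apply/mapP.
by exists (j %% n)%N; rewrite // mem_iota ltn_mod.
Qed.

(** This puts all three families in the form of generated subalgebras, so that
    the coideal property, images and fixed points can be read off on
    generators. *)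
Lemma taft_grp_agenv d : taft_grp hw d = agenv <[g ^+ d]>.
Proof.
apply/subv_anti/andP; split.
  apply/span_subvP=> _ /mapP[j _ ->].
  by rewrite subalgX ?mem1_agenv ?agenvM // memvE sub_agenv.
rewrite agenv_sub_modl -?memvE //; first by have := mem_grp d 0; rewrite muln0.
apply/prodvP=> u v /vlineP[c ->] dv.
suff/subvP sub: (taft_grp hw d <= amull (g ^+ d) @^-1: taft_grp hw d)%VS.
  by have := sub v dv; rewrite -memv_preim lfunE /= -scalerAl => /memvZ->.
apply/span_subvP=> _ /mapP[j _ ->].
by rewrite -memv_preim lfunE /= -exprS -exprM mem_grp.
Qed.

Lemma comul_gX j : comul (taft_hopf hw) (g ^+ j) = tens (g ^+ j) (g ^+ j).
Proof. by rewrite rmorphXn /= taft_comulg tensX. Qed.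

Lemma lcs_taft_grp d : lcs (taft_grp hw d).
Proof.
rewrite taft_grp_agenv; apply: agenv_left_coideal.
by rewrite limg_line comul_gX -memvE memv_tens ?memvf // memvE sub_agenv.
Qed.

Lemma mem_grpx d : g ^+ d \in taft_grpx hw d /\ x \in taft_grpx hw d.
Proof.
by split; apply: (subvP (sub_agenv _)); apply: memv_span;
  rewrite !inE eqxx ?orbT.
Qed.

Lemma lcs_taft_grpx d : lcs (taft_grpx hw d).
Proof.
have [Ng Nx] := mem_grpx d; apply: agenv_left_coideal.
rewrite limg_span; apply/span_subvP=> _ /mapP[u + ->].
rewrite !inE => /orP[] /eqP->.
  by rewrite comul_gX memv_tens ?memvf.
by rewrite /= taft_comulx memvD // memv_tens ?memvf ?mem1_agenv.
Qed.

Lemma mem_beta (c : k) : g + c *: x \in taft_beta hw c.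
Proof. by rewrite memvE sub_agenv. Qed.

Lemma lcs_taft_beta (c : k) : lcs (taft_beta hw c).
Proof.
apply: agenv_left_coideal; rewrite limg_line -memvE linearD linearZ /=.
have -> : taft_comul hw g + c *: taft_comul hw x =
    c *: tens x 1 + tens g (g + c *: x).
  rewrite taft_comulg taft_comulx [g + _]addrC tens_linearr scalerDr.
  by rewrite [RHS]addrA [RHS]addrC.
rewrite memvD //.
  by rewrite memvZ // memv_tens ?memvf ?mem1_agenv.
by apply: memv_tens; rewrite ?memvf ?mem_beta.
Qed.

Lemma lcs_with_x N : lcs N -> x \in N ->
  exists2 d, (d %| n)%N & N = taft_grpx hw d.
Proof.
move=> lN Nx; have [d dn gd] := lcs_grp lN; exists d => //.
have [N1 NN _] := lN; have [dg dx] := mem_grpx d.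
apply/subv_anti/andP; split; last first.
  apply: agenv_min => //; apply/span_subvP=> u.
  by rewrite !inE => /orP[] /eqP-> //; rewrite gd.
apply: (lcs_affine (c := 0)) => //; first by rewrite scale0r addr0.
move=> m j; rewrite gd scale0r addr0 => /dvdnP[q ->].
have [d1 dd _] := lcs_taft_grpx d.
by rewrite mulnC exprM subalgM // subalgX.
Qed.

Lemma lcs_with_affine N (c : k) : lcs N -> x + c *: g \in N -> x \notin N ->
  c != 0 /\ N = taft_beta hw c^-1.
Proof.
move=> lN Nxg N'x; have [N1 NN _] := lN.
have c0 : c != 0.
  by apply: contraNneq N'x => c0; rewrite c0 scale0r addr0 in Nxg.
have xgE : x + c *: g = c *: (g + c^-1 *: x).
  by rewrite scalerDr scalerA mulfV // scale1r addrC.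
split=> //; apply/subv_anti/andP; split; last first.
  apply: agenv_min => //; rewrite -memvE.
  by rewrite xgE rpredZeq (negPf c0) in Nxg.
apply: (lcs_affine lN Nxg) => m j Nj.
suff /dvdnP[q ->] : (n %| j)%N.
  rewrite mulnC exprM taft_gn expr1n mulr1.
  have [b1 bb _] := lcs_taft_beta c^-1.
  by rewrite subalgX // xgE memvZ ?mem_beta.
(* Subtracting x + c g from its conjugate by g^j leaves (w^j - 1) x. *)
apply: contraNT N'x; rewrite (prim_order_dvd hw) -subr_eq0 => wj.
have : g ^+ j * (x + c *: g) * g ^+ j ^+ n.-1 - (x + c *: g) \in N.
  by rewrite memvB // !subalgM // subalgX.
have -> : g ^+ j * (x + c *: g) = (w ^+ j *: x + c *: g) * g ^+ j.
  rewrite mulrDr mulrDl -!scalerAl -!scalerAr -exprS -exprSr.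
  by have := qcommX (taft_gx hw) j 1; rewrite muln1 !expr1 => ->.
rewrite -exprM [(j * _)%N]mulnC -mulrA gV_exp mulr1 opprD addrACA subrr addr0.
by rewrite -{2}[x]scale1r -scalerBl rpredZeq (negPf wj).
Qed.

Lemma lcs_without_affine N : lcs N -> (forall c : k, x + c *: g \notin N) ->
  exists2 d, (d %| n)%N & N = taft_grp hw d.
Proof.
move=> lN Nxg; have [d dn gd] := lcs_grp lN; exists d => //.
have [N1 NN _] := lN.
apply/subv_anti/andP; split; last first.
  by apply/span_subvP=> _ /mapP[j _ ->]; rewrite subalgX // gd.
apply: (lcs_generated (e := fun m j => g ^+ j)) => h m j hm Nh hj.
have Ngj := lcs_top lN hm Nh hj; split=> //.
  by move: Ngj; rewrite gd => /dvdnP[q ->]; rewrite mulnC mem_grp.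
case: m hm hj => [|m] hm hj a b _.
  by rewrite taft_gX coef_mono // (eq_sym a) (eq_sym (b %% n)%N).
by have [c Nc] := lcs_subtop lN hm Nh hj; case/negP: (Nxg c).
Qed.

Lemma lcs_cases N : lcs N ->
  [\/ exists2 d, (d %| n)%N & N = taft_grp hw d,
      exists2 d, (d %| n)%N & N = taft_grpx hw d |
      exists2 beta : k, beta != 0 & N = taft_beta hw beta].
Proof.
move=> lN; have [Nx|N'x] := boolP (x \in N).
  by constructor 2; apply: lcs_with_x.
(* That some x + c g lies in N means that x is in N + kg, which is decidable. *)
have [/memv_addP[u Nu [_ /vlineP[c ->] xE]]|Nxg] := boolP (x \in N + <[g]>)%VS.
  have Nxc : x + (- c) *: g \in N by rewrite xE scaleNr addrK.
  have [c0 NE] := lcs_with_affine lN Nxc N'x.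
  by constructor 3; exists (- c)^-1; rewrite // invr_eq0.
constructor 1; apply: lcs_without_affine lN _ => c.
apply: contraNN Nxg => Nxc; apply/memv_addP; exists (x + c *: g) => //.
by exists (- c *: g); rewrite ?memvZ ?memv_line // scaleNr addrK.
Qed.

End Classification.

(** * Automorphisms scaling x and g *)

Section DiagonalAutomorphisms.
Variables (k : fieldType) (n : nat) (w : k) (hw : n.-primitive_root w).
Local Notation H := (taft hw).
Local Notation x := (taft_x hw).
Local Notation g := (taft_g hw).
Local Notation S := (taft_hopf hw).
Implicit Types (c z : k) (d j : nat).

Fact taft_diag_xn c : (c *: x) ^+ n = 0.
Proof. by rewrite exprZn taft_xn scaler0. Qed.

Fact taft_diag_gn z : z ^+ n = 1 -> (z *: g) ^+ n = 1.
Proof. by move=> zn; rewrite exprZn zn taft_gn scale1r. Qed.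

Fact taft_diag_gx c z : (z *: g) * (c *: x) = w *: ((c *: x) * (z *: g)).
Proof.
rewrite -!scalerAl -!scalerAr taft_gx !scalerA; congr (_ *: _).
by rewrite -mulrA mulrC [c * w]mulrC.
Qed.

(** Packed as a sigma-type with an opaque proof, so that simplification does not
    unfold the automorphism. *)
Fact taft_diag_key c z : z ^+ n = 1 -> {f : 'AEnd(H) | forall a b,
  f (mono hw a b) = (c ^+ a * z ^+ b) *: mono hw a b}.
Proof.
move=> zn; exists (AHom (taft_lift_ahom hw (taft_diag_xn c) (taft_diag_gn zn)
  (taft_diag_gx c z))) => a b.
rewrite [LHS](taft_lift_mono hw _ _ (taft_diag_xn c) (taft_diag_gn zn)).
by rewrite !exprZn -scalerAl -scalerAr scalerA -monoE.
Qed.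

Definition taft_diag c z (zn : z ^+ n = 1) : 'AEnd(H) :=
  sval (taft_diag_key c zn).

Lemma taft_diag_mono c z (zn : z ^+ n = 1) a b :
  taft_diag c zn (mono hw a b) = (c ^+ a * z ^+ b) *: mono hw a b.
Proof. exact: svalP (taft_diag_key c zn) a b. Qed.

Lemma taft_diag_x c z (zn : z ^+ n = 1) : taft_diag c zn x = c *: x.
Proof. by rewrite taft_diag_mono mulr1. Qed.

Lemma taft_diag_g c z (zn : z ^+ n = 1) : taft_diag c zn g = z *: g.
Proof. by rewrite taft_diag_mono mul1r. Qed.

Lemma taft_diag_comp c c' z z' (zn : z ^+ n = 1) (zn' : z' ^+ n = 1) :
  c * c' = 1 -> z * z' = 1 -> cancel (taft_diag c zn) (taft_diag c' zn').
Proof.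
move=> cc zz h; move: h; apply: taft_ext => [a u v|//|a b _ _].
  by rewrite !linearP.
rewrite taft_diag_mono linearZ /= taft_diag_mono scalerA mulrACA -!exprMn.
by rewrite cc zz !expr1n mulr1 scale1r.
Qed.

Lemma taft_scale_hopf_aut c : c != 0 -> hopf_aut S (taft_diag c (expr1n k n)).
Proof.
move=> c0; set f := taft_diag _ _.
have fx : f x = c *: x by rewrite taft_diag_x.
have fg : f g = g by rewrite taft_diag_g scale1r.
split=> [|h|h|h].
- exists (taft_diag c^-1 (expr1n k n));
    apply: taft_diag_comp; rewrite ?mulr1 //.
    by rewrite mulfV.
  by rewrite mulVf.
- set F := fun u v : H => tens (f u) (f v).
  have Fl v : linear (F^~ v) by move=> a s t; rewrite /F linearP tens_linearl.
  have Fr u : linear (F u) by move=> a s t; rewrite /F !linearP.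
  have FM u v s t : F (u * s) (v * t) = F u v * F s t.
    by rewrite /F !ahomM tensM.
  have Sx : comul S x = tens x 1 + tens g x := taft_comulx hw.
  have Sg : comul S g = tens g g := taft_comulg hw.
  move: (comul S) Sx Sg => D Sx Sg.
  move: h; apply: taft_gen_ind => [a u v IHu IHv|u v IHu IHv|||].
  + by rewrite !linearP /= IHu IHv.
  + by rewrite !ahomM (tliftM Fl Fr FM) IHu IHv.
  + by rewrite !rmorph1 -tens1 tlift_tens // /F rmorph1.
  + rewrite fx linearZ /= Sx scalerDr raddfD /= !tlift_tens // /F fx fg rmorph1.
    rewrite (linear_scale (tens_linearl _)).
    by rewrite (linear_scale (tens_linearr _)).
  by rewrite fg Sg tlift_tens // /F fg.
- have Sx : counit S x = 0 := taft_counitx hw.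
  move: (counit S) Sx => D Sx.
  move: h; apply: taft_gen_ind => [a u v IHu IHv|u v IHu IHv|||].
  + by rewrite !linearP /= IHu IHv.
  + by rewrite !ahomM IHu IHv.
  + by rewrite !rmorph1.
  + by rewrite fx linearZ /= Sx scaler0.
  by rewrite fg.
move: h; apply: taft_gen_ind => [a u v IHu IHv|u v IHu IHv|||].
- by rewrite !linearP /= IHu IHv.
- by rewrite ahomM !taft_antipodeM ahomM IHu IHv.
- by rewrite rmorph1 !taft_antipode1 rmorph1.
- rewrite fx linearZ /= taft_antipodex scalerN [RHS]linearN /= ahomM fx.
  rewrite taft_gV rmorphXn /=.
  by rewrite fg -scalerAr.
by rewrite fg taft_antipodeg taft_gV rmorphXn /= fg.
Qed.

End DiagonalAutomorphisms.

(** * Distinguishing the subalgebras *)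

Section Distinctness.
Variables (k : fieldType) (n : nat) (w : k) (hw : n.-primitive_root w).
Hypothesis n_gt1 : (1 < n)%N.
Local Notation H := (taft hw).
Local Notation x := (taft_x hw).
Local Notation g := (taft_g hw).
Implicit Types (c z : k) (d j : nat).

(** With z = w^(n/d), the automorphism that fixes x and sends g to z g fixes the
    generators g^d and x, whereas it fixes g^j only if z^j = 1, that is, if d
    divides j. *)
Lemma gX_grpx d j : (d %| n)%N -> (g ^+ j \in taft_grpx hw d) = (d %| j)%N.
Proof.
move=> dn; apply/idP/idP=> [gj|/dvdnP[q ->]]; last first.
  have [d1 dd _] := lcs_taft_grpx hw d; have [dg _] := mem_grpx hw d.
  by rewrite mulnC exprM subalgX.
have d0 : (0 < d)%N by apply: dvdn_gt0 dn; apply: ltnW.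
pose z := w ^+ (n %/ d).
have zd : z ^+ d = 1 by rewrite -exprM divnK // (prim_expr_order hw).
have zn : z ^+ n = 1 by rewrite -(divnK dn) mulnC exprM zd expr1n.
have gE i : taft_diag hw 1 zn (g ^+ i) = z ^+ i *: g ^+ i.
  by rewrite taft_gX taft_diag_mono mul1r.
have := agenv_fixed (f := taft_diag hw 1 zn) _ gj => /(_ _)/eqP.
rewrite gE -subr_eq0 -{2}[g ^+ j]scale1r -scalerBl scaler_eq0.
rewrite [_ ^+ j in X in _ || X]taft_gX (negPf (mono_neq0 _ _ (ltnW n_gt1))).
rewrite orbF subr_eq0 -exprM -(prim_order_dvd hw) => gj1.
suff: (n %/ d * d %| n %/ d * j)%N.
  by rewrite dvdn_pmul2l // divn_gt0 // dvdn_leq // ltnW.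
rewrite divnK //; apply: gj1; apply: span_fixed => u.
rewrite !inE => /orP[] /eqP->; last by rewrite taft_diag_x scale1r.
by rewrite gE zd scale1r.
Qed.

Lemma sub_grp_grpx d : (taft_grp hw d <= taft_grpx hw d)%VS.
Proof.
have [d1 dd _] := lcs_taft_grpx hw d; have [dg _] := mem_grpx hw d.
by apply/span_subvP=> _ /mapP[j _ ->]; apply: subalgX.
Qed.

Lemma gX_grp d j : (d %| n)%N -> (g ^+ j \in taft_grp hw d) = (d %| j)%N.
Proof.
move=> dn; apply/idP/idP=> [/(subvP (sub_grp_grpx d))|/dvdnP[q ->]].
  by rewrite gX_grpx.
by rewrite mulnC mem_grp.
Qed.

Lemma w_neq1 : w - 1 != 0.
Proof.
by rewrite subr_eq0 -(expr1 w) -(prim_order_dvd hw) dvdn1 gtn_eqF.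
Qed.

(** The automorphism that fixes g and sends x to w x is trivial on k<g^d> but
    moves x, as w <> 1. *)
Lemma affine_notin_grp (a c : k) d : c != 0 ->
  a *: g + c *: x \notin taft_grp hw d.
Proof.
move=> c0; apply/negP; rewrite taft_grp_agenv => xd.
have := agenv_fixed (f := taft_diag hw w (expr1n k n)) _ xd => /(_ _)/eqP.
rewrite linearD !linearZ /= taft_diag_x taft_diag_g scale1r (inj_eq (addrI _)).
rewrite (can_eq (scalerK c0)) -subr_eq0 -{2}[x]scale1r -scalerBl scaler_eq0.
rewrite (negPf w_neq1) (negPf (mono_neq0 _ _ n_gt1)) => xf.
suff: false by []; apply: xf => _ /vlineP[b ->]; rewrite linearZ taft_gX.
by rewrite /= taft_diag_mono mul1r expr1n scale1r.
Qed.

(** If x belonged to N_beta, so would g = (g + beta x) - beta x; but N_beta is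
    commutative and g x = w x g. *)
Lemma x_notin_beta c : c != 0 -> x \notin taft_beta hw c.
Proof.
move=> c0; apply/negP=> bx.
have bg : g \in taft_beta hw c.
  by rewrite -[g](addrK (c *: x)) memvB ?mem_beta // memvZ.
have := agenv_line_comm bg bx; rewrite taft_gx => /eqP.
rewrite -subr_eq0 -{2}[x * g]scale1r -scalerBl scaler_eq0 (negPf w_neq1) /=.
by rewrite monoM mul0n scale1r (negPf (mono_neq0 _ _ n_gt1)).
Qed.

End Distinctness.

(** * Hopf automorphisms and orbits *)

Section HopfAutomorphisms.
Variables (k : fieldType) (n : nat) (w : k) (hw : n.-primitive_root w).
Hypothesis n_gt1 : (1 < n)%N.
Local Notation H := (taft hw).
Local Notation x := (taft_x hw).
Local Notation g := (taft_g hw).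
Local Notation S := (taft_hopf hw).
Local Notation coef := (@coef k n w hw).
Implicit Types (f : 'AEnd(H)) (d j : nat).

Let n_gt0 : (0 < n)%N. Proof. exact: ltnW. Qed.

Lemma coef_gX a b j : coef a b (g ^+ j) = ((a == 0%N) && (j == b %[mod n]))%:R.
Proof. by rewrite taft_gX coef_mono // (eq_sym a). Qed.

Lemma gX_eq1 j : g ^+ j = 1 -> (n %| j)%N.
Proof.
move/(congr1 (coef 0 0)); rewrite -(expr0 g) !coef_gX eqxx mod0n.
by rewrite /dvdn; case: eqP => // _ /eqP; rewrite eq_sym oner_eq0.
Qed.

Lemma tlift_tens_hom f u v :
  tlift (fun a b => tens (f a) (f b)) (tens u v) = tens (f u) (f v).
Proof.
by rewrite tlift_tens // => [b|a] c s t; rewrite !linearP // tens_linearl.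
Qed.

(** Every slice of a grouplike y is a multiple of y, while the slice at its top
    coefficient is a multiple of a power of g; the two scalars agree. *)
Lemma hopf_aut_grouplike f : hopf_aut S f -> exists j, f g = g ^+ j.
Proof.
case=> [bij_f fcomul _ _]; have inj_f := bij_inj bij_f.
have fg0 : f g != 0.
  rewrite -(linear0 f) (inj_eq inj_f).
  by apply: contraTneq (taft_g_unit hw) => ->; rewrite unitr0.
have [m [j [hm mn mj]]] := xdeg_le_nonzero fg0; exists j.
have := slice_top j hm.
rewrite /slice fcomul (taft_comulg hw : comul S g = tens g g) tlift_tens_hom.
by rewrite lslice_tens => /(scalerI mj).
Qed.

Lemma hopf_aut_skew f j (phi : {linear H -> k^o}) :
    hopf_aut S f -> f g = g ^+ j ->
  slice phi (f x) = (phi (f x) : k) *: 1 + (phi (g ^+ j) : k) *: f x.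
Proof.
case=> [_ fcomul _ _] fg.
rewrite /slice fcomul (taft_comulx hw : comul S x = tens x 1 + tens g x).
by rewrite raddfD /= !tlift_tens_hom rmorph1 fg raddfD /= !lslice_tens.
Qed.

(** Write z = f(x) and f(g) = g^j.  The rule g x = w x g gives w^(j a) = w for
    each a such that x^a occurs in z, which excludes a = 0.  The slices of z are
    its coefficients times 1, up to a multiple of z that vanishes for the forms
    dual to x^m g^l with m > 0.  Hence the top coefficients of z are those of
    x^m alone, and a degree m > 1 is impossible because the form of
    [slice_subtop] would give x as a multiple of 1 modulo powers of g.  Finally
    m = 1 in w^(j m) = w gives g^j = g. *)
Lemma hopf_aut_diag f : hopf_aut S f ->
  f g = g /\ exists2 c : k, c != 0 & f x = c *: x.
Proof.
move=> autf; have [j fg] := hopf_aut_grouplike autf.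
have [bij_f _ _ _] := autf; have inj_f := bij_inj bij_f.
have fx0 : f x != 0.
  by rewrite -(linear0 f) (inj_eq inj_f) (mono_neq0 _ _ n_gt1).
have skew phi := hopf_aut_skew phi autf fg.
have wj a b : coef a b (f x) != 0 -> w ^+ (j * a) = w.
  move=> hab; have /(congr1 (coef a (b + j))) : f g * f x = w *: (f x * f g).
    by rewrite -!ahomM taft_gx linearZ.
  by rewrite fg linearZ /= coef_gmul coef_mulg => /(mulIf hab).
have coef0 b : coef 0 b (f x) = 0.
  apply: contraTeq (w_neq1 hw n_gt1) => /wj; rewrite muln0 expr0 => <-.
  by rewrite subrr eqxx.
have top m l : xdeg_le m (f x) -> coef m l (f x) != 0 -> (n %| l)%N.
  case: m => [|m] hm ml; first by rewrite coef0 eqxx in ml.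
  apply: gX_eq1; have := slice_top l hm.
  by rewrite skew /= coef_gX scale0r addr0 => /(scalerI ml).
have [m [l [hm mn ml]]] := xdeg_le_nonzero fx0.
have m1 : m = 1%N.
  case: m hm mn ml => [|[//|m]] hm mn ml; first by rewrite coef0 eqxx in ml.
  have /(congr1 (coef 1 l)) := slice_subtop l hm.
  rewrite skew -(expr0 g) !linearD !linearZ /= !coef_gX /= scale0r.
  rewrite !scaler0 !addr0 -[x]expr1 -monoE coef_mono // !eqxx => /esym/eqP.
  rewrite [_ *: _]mulr1 mulf_eq0 (negPf ml) orbF.
  by rewrite (negPf (qbin_subtop_neq0 hw mn)).
rewrite {m}m1 in hm mn ml.
split.
  rewrite fg; move: (wj _ _ ml); rewrite muln1 -{2}(expr1 w) => /eqP.
  rewrite (eq_prim_root_expr hw) => /eqP j1.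
  by rewrite taft_gX -mono_mod j1 mono_mod.
exists (coef 1 0 (f x)).
  by have /dvdnP[q lE] := top _ _ hm ml; move: ml; rewrite -coef_mod lE modnMl.
rewrite [LHS]taft_coefE [RHS]taft_coefE.
apply: eq_bigr => a _; apply: eq_bigr => b _; congr (_ *: _).
rewrite linearZ /= coef_mono // mod0n.
case: (ltngtP a 1%N) => [|a1|->].
- by rewrite ltnS leqn0 => /eqP->; rewrite coef0 scaler0.
- by rewrite hm // scaler0.
rewrite /= (modn_small (ltn_ord b)); case: eqP => [<-|/eqP b0].
  by rewrite [RHS]mulr1.
rewrite scaler0; apply: contraNeq b0 => /(top _ _ hm) nb; rewrite eq_sym.
by rewrite -(modn_small (ltn_ord b)).
Qed.

Lemma hopf_orbit_fixed (N : {vspace H}) :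
    (forall f, hopf_aut S f -> (f @: N)%VS = N) ->
  hopf_orbit S N = [set N]%classic.
Proof.
move=> fN; apply/seteqP; split=> [_ [f /fN-> <-] //|_ ->].
have aut1 := taft_scale_hopf_aut hw (oner_neq0 k).
by exists (taft_diag hw 1 (expr1n k n)); rewrite ?fN.
Qed.

Lemma hopf_orbit_grp d :
  hopf_orbit S (taft_grp hw d) = [set taft_grp hw d]%classic.
Proof.
apply: hopf_orbit_fixed => f /hopf_aut_diag[fg _].
by rewrite taft_grp_agenv aimg_agen limg_line rmorphXn /= fg.
Qed.

Lemma hopf_orbit_grpx d :
  hopf_orbit S (taft_grpx hw d) = [set taft_grpx hw d]%classic.
Proof.
apply: hopf_orbit_fixed => f /hopf_aut_diag[fg [c c0 fx]].
rewrite /taft_grpx aimg_agen limg_span /= rmorphXn /= fg fx.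
by rewrite !span_cons line_scale.
Qed.

Lemma hopf_orbit_beta (beta : k) : beta != 0 ->
  hopf_orbit S (taft_beta hw beta) =
    [set taft_beta hw b | b in [set b : k | b != 0]]%classic.
Proof.
move=> beta0.
have img f c : f g = g -> f x = c *: x ->
    (f @: taft_beta hw beta)%VS = taft_beta hw (beta * c).
  by move=> fg fx; rewrite aimg_agen limg_line linearD linearZ /= fg fx scalerA.
apply/seteqP; split=> N.
  case=> f /hopf_aut_diag[fg [c c0 fx]] <-; exists (beta * c).
    by rewrite /= mulf_neq0.
  by rewrite (img f c).
case=> b /= b0 <-.
exists (taft_diag hw (beta^-1 * b) (expr1n k n)).
  by apply: taft_scale_hopf_aut; rewrite mulf_neq0 // invr_eq0.
rewrite (img _ (beta^-1 * b)) ?taft_diag_x ?taft_diag_g ?scale1r //.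
by rewrite mulVKf.
Qed.

End HopfAutomorphisms.

Theorem corollary4p7 (k : fieldType) (n : nat) (w : k) (n_ge2 : (2 <= n)%N)
    (hw : n.-primitive_root w) :
  (coideal_orbits (taft_hopf hw) =
     [set [set taft_grp hw d] | d in [set d : nat | (d %| n)%N]]
     `|` [set [set taft_grpx hw d] | d in [set d : nat | (d %| n)%N]]
     `|` [set [set taft_beta hw beta | beta in [set b : k | b != 0]]])%classic
  /\ (forall d e : nat, (d %| n)%N -> (e %| n)%N ->
        [/\ taft_grp hw d = taft_grp hw e -> d = e,
            taft_grpx hw d = taft_grpx hw e -> d = e
          & taft_grp hw d <> taft_grpx hw e])
  /\ (forall (d : nat) (beta : k), (d %| n)%N -> beta != 0 ->
        taft_beta hw beta <> taft_grp hw d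
        /\ taft_beta hw beta <> taft_grpx hw d).
Proof.
split; [|split].
- apply/seteqP; split=> O.
    case=> N /lcs_cases[[d dn ->]|[d dn ->]|[beta beta0 ->]] <-.
    + by left; left; exists d; rewrite ?hopf_orbit_grp.
    + by left; right; exists d; rewrite ?hopf_orbit_grpx.
    by right; rewrite hopf_orbit_beta.
  case=> [[[d dn <-]|[d dn <-]]|->].
  + exists (taft_grp hw d); first exact: lcs_taft_grp.
    exact: hopf_orbit_grp.
  + exists (taft_grpx hw d); first exact: lcs_taft_grpx.
    exact: hopf_orbit_grpx.
  exists (taft_beta hw 1); first exact: lcs_taft_beta.
  by apply: hopf_orbit_beta; rewrite ?oner_neq0.
- move=> d e dn en; split=> [E|E|E].
  + apply/eqP; rewrite eqn_dvd -(gX_grp hw n_ge2 e dn) -(gX_grp hw n_ge2 d en).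
    by rewrite E {1}gX_grp // -E gX_grp // !dvdnn.
  + apply/eqP; rewrite eqn_dvd.
    rewrite -(gX_grpx hw n_ge2 e dn) -(gX_grpx hw n_ge2 d en).
    by rewrite E {1}gX_grpx // -E gX_grpx // !dvdnn.
  have := affine_notin_grp hw n_ge2 0 d (oner_neq0 k).
  by rewrite scale0r add0r scale1r E; have [_ ->] := mem_grpx hw e.
move=> d beta dn beta0; split=> E.
  have := affine_notin_grp hw n_ge2 1 d beta0.
  by rewrite scale1r -E mem_beta.
have := x_notin_beta hw n_ge2 beta0.
by rewrite E; have [_ ->] := mem_grpx hw d.
Qed.
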